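(* Let $D$ be a Go-diagram in a partition $\lambda\in\Lambda_{k,n}$ and let $I\in\binom{[n]}{k}$. Then $$\Delta_I(R_D)=\sum_{\substack{E\in\mathfrak D(D)\\ I_E=I}}\mathrm{sign}(\pi_E)\,\mathrm{wt}(E),$$ where $\mathrm{wt}(E)$ is the product of the jump parameters $\beta_b$ over the toggled cells $b$ of $E$.
   Context: **Partitions and pipe dreams.** Let $k\le n$ be natural numbers. $\Lambda_{k,n}$ is the set of partitions $\lambda=(\lambda_1\ge\dots\ge\lambda_k\ge 0)$ with $\lambda_1\le n-k$; $\lambda$ is identified with its Young diagram (English notation) in the top-left corner of a rectangle with $k$ rows and $n-k$ columns. The south-east border of $\lambda$ is the lattice path from the north-east corner to the south-west corner of the rectangle bounding $\lambda$; its $n$ unit edges are labelled $1,\dots,n$ starting from the north-east end. The north-west border consists of the top side of the rectangle ($n-k$ edges, the north boundary) and its left side ($k$ edges, the west boundary). For cells $b,c$ write $b\prec c$ if $c$ is weakly north-west of $b$, and $c_{in}=\{b: b\prec c\}$. A pipe dream on $\lambda$ is a filling of every cell by a crossing tile or an elbow tile. Pipe $j$ starts at the south-east border edge labelled $j$ and travels to the north-west border: it enters each cell through its east or south edge; in a crossing tile east continues to west and south continues to north; in an elbow tile east turns to north and south turns to west. Each edge of the north-west border is labelled by the index of the pipe exiting there; reading these labels from the north-east corner to the south-west corner (top side right to left, then left side top to bottom) gives the permutation of the pipe dream. Given a pipe dream, write $+$ in each elbow cell; in a crossing cell write $\circ$ (white stone) if the pipe entering from the east has the smaller index of the two pipes,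 and $\bullet$ (black stone) if the pipe entering from the east has the larger index. A pipe dream is a Go-diagram if in no elbow cell the pipe entering from the east has larger index than the pipe entering from the south. **Restricted path matrix.** The edges of the north-west border are sources, those of the south-east border are sinks. A restricted path goes from a source to a sink along the pipes of $D$ (traversed from the north-west border towards the south-east border), following the pipe it is on, except that upon entering a cell with $+$ or $\bullet$ it may alternatively jump to the other pipe of that cell provided that pipe has the lower index. A cell where it changes pipes is a jump site. A jump parameter $\beta_b$ is attached to each cell $b$, with values in $\mathbb F=\mathbb R$ or $\mathbb C$: $\beta_b\in\mathbb F$ at $\bullet$, $\beta_b\in\mathbb F\setminus\{0\}$ at $+$, $\beta_b=0$ at $\circ$. The weight of a restricted path is the product of the jump parameters at its jump sites, and $(\tilde R_D)_{st}$ is the sum of the weights of the restricted paths from the source labelled $s$ to the sink labelled $t$. If $v_1,\dots,v_k$ are the labels on the west boundary from top to bottom, $R_D$ is the $k\times n$ matrix $(R_D)_{st}=(\tilde R_D)_{v_st}$. $\binom{[n]}{k}$ is the set of $k$-element subsets of $\{1,\dots,n\}$, and $\Delta_I(R_D)$ is the maximal minor of $R_D$ with columns $I$ (in increasing order). **Restricted diagrams.** A $(+,\circ)$ diagram is a filling of $\lambda$ by $+$ (elbow tile) and $\circ$ (crossing tile), regarded as a pipe dream. $D$ is regarded as a $(+,\circ)$ diagram by decolouring its black stones to $\circ$. Toggling a cell exchanges $+$ and $\circ$ in it. In a $(+,\circ)$ diagram $E$ with some cells marked as toggled, a cell $p$ is togglable if: (1) toggling $p$ swaps $b$ and $c$,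 where $b$ is the label of a pipe on the west boundary and $c$ is a label on the north boundary ($b,c$ being the two pipes through $p$); (2) toggling $p$ increases the length of the permutation of the diagram; (3) no toggled cell lies in $p_{in}$. Additionally, all cells with a white stone in $D$ are declared untogglable. After toggling $p$, the toggled cells are the previously toggled cells together with $p$. A restricted diagram obtained from $D$ is a diagram $E$ for which there is a sequence $D=E_0,E_1,\dots,E_m=E$, with no cell of $E_0$ toggled and each $E_{i+1}$ obtained from $E_i$ by toggling a togglable cell. $\mathfrak D(D)$ is the set of all restricted diagrams obtained from $D$. For $E\in\mathfrak D(D)$, let $(p_1,\dots,p_k)$ be the labels of the pipes of $E$ on the west boundary read from top to bottom, $I_E=\{p_1,\dots,p_k\}$, and let $\pi_E\in\mathfrak S_k$ be the permutation with $p_{\pi_E(1)}\le p_{\pi_E(2)}\le\dots\le p_{\pi_E(k)}$. *)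

(* Defs.v *)
From HB Require Import structures.
From mathcomp Require Import all_boot all_order all_fingroup all_algebra.

Set Implicit Arguments.
Unset Strict Implicit.
Unset Printing Implicit Defensive.

Import GRing.Theory.

Section PipeDreams.

Variables k n : nat.

(* All indices (rows, columns, edge labels) are 0-based: the label written    *)
(* l : 'I_n here is l + 1 in the usual 1-based numbering.                     *)

Definition in_Lambda (la : k.-tuple nat) : bool :=
  sorted geq la && all (fun l => l <= n - k) la.

(* Cells (row, column) of the k x (n - k) rectangle. *)
Definition cell : finType := ('I_k * 'I_(n - k))%type.

(* Unit edges of the rectangle grid: inl (i, j) is the horizontal edge of     *)
(* column j at depth i (i = 0 is the top side), inr (i, j) is the vertical    *)
(* edge of row i at abscissa j (j = 0 is the left side).                      *)
Definition edge : finType := ('I_k.+1 * 'I_(n - k) + 'I_k * 'I_(n - k).+1)%type.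

Definition north (c : cell) : edge := inl (widen_ord (leqnSn k) c.1, c.2).
Definition south (c : cell) : edge := inl (lift ord0 c.1, c.2).
Definition west (c : cell) : edge := inr (c.1, widen_ord (leqnSn (n - k)) c.2).
Definition east (c : cell) : edge := inr (c.1, lift ord0 c.2).

Definition north_edge (j : 'I_(n - k)) : edge := inl (ord0, j).
Definition west_edge (i : 'I_k) : edge := inr (i, ord0).

Definition nw_border : seq edge :=
  [seq north_edge j | j <- rev (enum 'I_(n - k))] ++
  [seq west_edge i | i <- enum 'I_k].

(* The number of unit steps (west or south) that a lattice path from the      *)
(* north-east corner of the rectangle makes before it reaches the edge; hence *)
(* the label of the edge when it lies on the south-east border.               *)
Definition edge_pos (e : edge) : nat :=
  match e with
  | inl (i, j) => i + (n - k - j.+1)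
  | inr (i, j) => i + (n - k - j)
  end.

(* c_in consists of the b such that prec b c. *)
Definition prec (b c : cell) : bool := (c.1 <= b.1) && (c.2 <= b.2).

(* D c = true: elbow tile (+) in c; D c = false: crossing tile in c.  Only    *)
(* the values at the cells of the partition at hand are ever consulted.       *)
Definition filling : finType := {ffun cell -> bool}.

Definition toggle (E : filling) (p : cell) : filling :=
  [ffun c => if c == p then ~~ E c else E c].

Variable la : k.-tuple nat.

Definition in_shape (c : cell) : bool := c.2 < tnth la c.1.

Definition se_edge (e : edge) : bool :=
  match e with
  | inl (i, j) => i == #|[set r : 'I_k | j < tnth la r]| :> nat
  | inr (i, j) => j == tnth la i :> nat
  end.

(* The edge through which the pipe entering c by its east or south edge f     *)
(* leaves c.                                                                  *)
Definition through (D : filling) (c : cell) (f : edge) : edge :=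
  if f == east c then (if D c then north c else west c)
  else (if D c then west c else north c).

Definition advance (D : filling) (f : edge) : edge :=
  if [pick c | in_shape c & (f == east c) || (f == south c)] is Some c
  then through D c f else f.

(* The edges visited by the pipe that starts at the south-east border edge e0.*)
(* A pipe visits at most k + (n - k) - 1 cells, hence at most n edges;        *)
(* advance fixes the edges of the north-west border.                          *)
Definition pipe (D : filling) (e0 : edge) : seq edge :=
  traject (advance D) e0 n.

(* The index of the pipe through e (n if there is none). *)
Definition label (D : filling) (e : edge) : nat :=
  if [pick e0 | se_edge e0 & e \in pipe D e0] is Some e0
  then edge_pos e0 else n.

(* The permutation of a pipe dream, in one-line notation. *)
Definition dream_perm (D : filling) : seq nat := [seq label D e | e <- nw_border].

Definition perm_length (w : seq nat) : nat :=
  #|[set ab : 'I_(size w) * 'I_(size w) |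
      (ab.1 < ab.2) && (nth 0 w ab.2 < nth 0 w ab.1)]|.

Definition white (D : filling) (c : cell) : bool :=
  ~~ D c && (label D (east c) < label D (south c)).

Definition black (D : filling) (c : cell) : bool :=
  ~~ D c && (label D (south c) < label D (east c)).

Definition Go_diagram (D : filling) : Prop :=
  forall c : cell, in_shape c -> D c ->
    ~~ (label D (south c) < label D (east c)).

Definition west_label (D : filling) (i : 'I_k) : nat := label D (west_edge i).
Definition north_label (D : filling) (j : 'I_(n - k)) : nat :=
  label D (north_edge j).

(* A path enters c through e and leaves it through f, either staying on its   *)
(* pipe or jumping to the other pipe of c.                                    *)
Definition path_step (D : filling) (c : cell) (e f : edge) : bool :=
  [&& in_shape c, (e == north c) || (e == west c),
      (f == east c) || (f == south c) &
      (through D c f == e) ||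
      (D c || black D c) && (label D f < label D e)].

(* Restricted paths, as the sequences of edges they visit, from the source    *)
(* labelled s to the sink labelled t.                                         *)
Definition restricted_path (D : filling) (s t : nat) (p : seq edge) : bool :=
  if p is e :: q then
    [&& e \in nw_border, label D e == s,
        path (fun f g => [exists c, path_step D c f g]) e q,
        se_edge (last e q) & edge_pos (last e q) == t]
  else false.

Definition jump_site (D : filling) (p : seq edge) (c : cell) : bool :=
  has (fun ef => path_step D c ef.1 ef.2 && (through D c ef.2 != ef.1))
      (zip p (behead p)).

(* A marked diagram: a (+,o) diagram with its set of toggled cells. *)
Definition marked : finType := (filling * {set cell})%type.

(* Toggling p exchanges a label on the west boundary with a label on the      *)
(* north boundary, these being the labels of the two pipes through p.         *)
Definition swaps_west_north (E : filling) (p : cell) : bool :=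
  [exists i : 'I_k, exists j : 'I_(n - k),
    [&& perm_eq [:: west_label E i; north_label E j]
                [:: label E (east p); label E (south p)],
        west_label (toggle E p) i == north_label E j &
        north_label (toggle E p) j == west_label E i]].

Definition togglable (D : filling) (X : marked) (p : cell) : bool :=
  [&& in_shape p,
      swaps_west_north X.1 p,
      perm_length (dream_perm X.1) < perm_length (dream_perm (toggle X.1 p)),
      [forall b in X.2, ~~ prec b p] &
      ~~ white D p].

Definition toggle_step (D : filling) (X Y : marked) : bool :=
  [exists p, togglable D X p && (Y == (toggle X.1 p, p |: X.2))].

Definition restricted_diagrams (D : filling) : {set marked} :=
  [set X | connect (toggle_step D) (D, set0) X].

Definition boundary_set (E : filling) : {set 'I_n} :=
  [set t : 'I_n | [exists i : 'I_k, west_label E i == t :> nat]].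

(* The (unique) permutation pi such that the west boundary labels, read in    *)
(* the order pi 0, pi 1, ..., are nondecreasing.                              *)
Definition boundary_perm (E : filling) : 'S_k :=
  odflt 1%g [pick s : 'S_k | [forall i : 'I_k, forall j : 'I_k,
    (i <= j) ==> (west_label E (s i) <= west_label E (s j))]].

Local Open Scope ring_scope.

Variable F : fieldType.

Definition jump_parameters (D : filling) (beta : cell -> F) : Prop :=
  forall c : cell, in_shape c ->
    (D c -> beta c != 0) /\ (white D c -> beta c = 0).

(* A restricted path visits at most n edges. *)
Definition Rtilde (D : filling) (beta : cell -> F) (s t : nat) : F :=
  \sum_(p : n.-bseq edge | restricted_path D s t p)
    \prod_(c | jump_site D p c) beta c.

Definition path_matrix (D : filling) (beta : cell -> F) : 'M[F]_(k, n) :=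
  \matrix_(i, t) Rtilde D beta (west_label D i) t.

Definition wt (beta : cell -> F) (X : marked) : F := \prod_(b in X.2) beta b.

End PipeDreams.

(* The columns are taken in increasing order, as enum_val enumerates I so.    *)
Definition max_minor (F : fieldType) (k n : nat) (A : 'M[F]_(k, n))
    (I : {set 'I_n}) (hI : #|I| = k) : F :=
  (\det (colsub (fun j : 'I_k => enum_val (cast_ord (esym hI) j)) A))%R.

(* Main.v *)
Require Import Defs.
From mathcomp Require Import all_boot all_order all_fingroup all_algebra.

Set Implicit Arguments.
Unset Strict Implicit.
Unset Printing Implicit Defensive.

Import GRing.Theory.

(** The maximal minors of the path matrix are computed by crossing the cells
    of the diagram one at a time, from the north-west to the south-east.

    Follow the [k] pipes that end on the west boundary, starting from their
    sources.  In a Go-diagram the only possible jump at a cell leads from its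
    west edge to the pipe entering from the north ([path_stepE]), so crossing a
    cell acts on the rows of a determinant of path weights by changing at most
    one of them: the row standing at the west edge [w] of the cell becomes the
    row that follows the pipe of [w], plus [beta] times the row that follows the
    pipe of the north edge.  By multilinearity the determinant splits in two.
    If another row stands at the north edge, the second term has two equal rows
    and vanishes; otherwise it is the determinant obtained after toggling the
    tile of the cell ([det_path_rows_cons]).  Iterating over all cells gives a
    sum over the sets of cells at which a toggle is allowed in this sense
    ([det_path_rows]).  Once all cells are crossed, the rows are unit vectors
    placed at the labels of the west boundary, so that the remaining determinant
    is the sign of the permutation sorting them, or zero if these labels do not
    form the set of columns ([det_exit_matrix], [det_exit_matrix0]).

    These sets are the sets of toggled cells of the restricted diagrams.  As no
    cell south-east of a togglable cell [p] is toggled, the labels of the two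
    pipes through [p] are the same as in [D]; so the larger one is at the west
    edge, unless [p] holds a white stone ([white_pos]), where the jump parameter
    is zero anyway.  Exchanging a west with a north label lengthens the
    permutation exactly when the larger one sits on the west boundary.  So
    toggling [p] is allowed when the pipe of its west edge ends on the west
    boundary and that of its north edge does not ([togglableE]), which is the
    condition met in the expansion.  It depends only on the tiles north-west
    of [p] ([jumpable_local]), so the order of the toggles is immaterial, and the
    restricted diagrams are described by a condition on each toggled cell
    separately ([restricted_diagramsP]). *)

(** * Edges and cells of the grid *)

Section Grid.

Variables k n : nat.
Implicit Types (c : cell k n) (e f : edge k n) (E : filling k n).

(** Each cell that a pipe crosses on its way from the north-west raises the rank
    by one. *)
Definition rank e : nat :=
  match e with inl (i, j) => i + j | inr (i, j) => i + j end.

Definition cell_rank c : nat := c.1 + c.2.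

(** Directions are those of the restricted paths, from the north-west to the
    south-east. *)
Definition enters c e := (e == north c) || (e == west c).
Definition leaves c e := (e == east c) || (e == south c).

Lemma north_inj : injective (@north k n).
Proof. by move=> [i j] [i' j'] [/= hi ->]; congr pair; apply: val_inj. Qed.

Lemma west_inj : injective (@west k n).
Proof. by move=> [i j] [i' j'] [/= -> hj]; congr pair; apply: val_inj. Qed.

Lemma east_inj : injective (@east k n).
Proof. by move=> [i j] [i' j'] [/= -> hj]; congr pair; apply: val_inj. Qed.

Lemma south_inj : injective (@south k n).
Proof. by move=> [i j] [i' j'] [/= hi ->]; congr pair; apply: val_inj. Qed.

Lemma enters_inj c c' e : enters c e -> enters c' e -> c = c'.
Proof.
by move=> /orP[]/eqP-> /orP[]/eqP // h; [apply: north_inj | apply: west_inj].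
Qed.

Lemma leaves_inj c c' e : leaves c e -> leaves c' e -> c = c'.
Proof.
by move=> /orP[]/eqP-> /orP[]/eqP // h; [apply: east_inj | apply: south_inj].
Qed.

Lemma enters_north c : enters c (north c). Proof. by rewrite /enters eqxx. Qed.
Lemma enters_west c : enters c (west c).
Proof. by rewrite /enters eqxx orbT. Qed.
Lemma leaves_east c : leaves c (east c). Proof. by rewrite /leaves eqxx. Qed.
Lemma leaves_south c : leaves c (south c).
Proof. by rewrite /leaves eqxx orbT. Qed.

Lemma enters_rank c e : enters c e -> rank e = cell_rank c.
Proof. by case/orP=> /eqP->. Qed.

Lemma leaves_rank c e : leaves c e -> rank e = (cell_rank c).+1.
Proof. by case/orP=> /eqP->; rewrite /= /cell_rank /bump leq0n ?addnS. Qed.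

Lemma leaves_enters_rank c c' e :
  leaves c e -> enters c' e -> cell_rank c' = (cell_rank c).+1.
Proof. by move=> /leaves_rank hc /enters_rank <-. Qed.

Lemma leaves_enters_prec c c' e : leaves c e -> enters c' e -> prec c' c.
Proof.
case: c c' => [i j] [i' j'] /=.
by move=> /orP[]/eqP-> /orP[]/eqP // [] /= h h';
  rewrite /prec /= ?h ?h' ?leqnn ?andbT -?h -?h' ?leqnSn // /bump leq0n leqnSn.
Qed.

Lemma prec_trans c c' c'' : prec c c' -> prec c' c'' -> prec c c''.
Proof.
by rewrite /prec => /andP[h1 h2] /andP[h3 h4]; rewrite (leq_trans h3) ?(leq_trans h4).
Qed.

Lemma prec_refl c : prec c c. Proof. by rewrite /prec !leqnn. Qed.

Lemma prec_rank_eq c c' : prec c c' -> cell_rank c <= cell_rank c' -> c = c'.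
Proof.
case: c c' => [i j] [i' j'] /andP[/= h1 h2]; rewrite /cell_rank /= => h3.
by congr pair; apply/val_inj/eqP; rewrite /= eqn_leq ?h1 ?h2 ?andbT;
  [rewrite -(leq_add2r j) | rewrite -(leq_add2l i)]; apply: leq_trans h3 _;
  rewrite ?leq_add2l ?leq_add2r.
Qed.

Lemma rank_lt e : k <= n -> rank e < n.
Proof.
move=> hkn; case: e => [[i j]|[i j]] /=; rewrite -[ltnRHS](subnKC hkn).
  by rewrite -addnS leq_add // -ltnS.
by rewrite -addSn leq_add // -ltnS.
Qed.

Lemma edge_pos_lt e : k <= n -> edge_pos e < n.
Proof.
move=> hkn; case: e => [[i j]|[i j]] /=; rewrite -[ltnRHS](subnKC hkn).
  by rewrite -addnS subnSK // leq_add ?leq_subr // -ltnS.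
by rewrite -addSn leq_add // leq_subr.
Qed.

Lemma nw_borderP e :
  reflect ((exists j, e = north_edge j) \/ (exists i, e = west_edge n i))
          (e \in nw_border k n).
Proof.
rewrite /nw_border mem_cat; apply: (iffP orP) => [[]|[]].
- by case/mapP=> j _ ->; left; exists j.
- by case/mapP=> i _ ->; right; exists i.
- by case=> j ->; left; apply/map_f; rewrite mem_rev mem_enum.
by case=> i ->; right; apply/map_f; rewrite mem_enum.
Qed.

Lemma nw_border_leaves c e : e \in nw_border k n -> ~~ leaves c e.
Proof.
by case/nw_borderP=> [] [i ->]; apply/negP=> /orP[]/eqP // [] /(congr1 val).
Qed.

Lemma nw_border_uniq : uniq (nw_border k n).
Proof.
have [hN hW] : injective (@north_edge k n) /\ injective (@west_edge k n).
  by split=> i j [].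
rewrite /nw_border cat_uniq !map_inj_uniq // -enumT rev_uniq !enum_uniq andbT /=.
rewrite -all_predC; apply/allP=> e /mapP[i _ ->] /=.
by apply/negP=> /mapP[].
Qed.

(** Pipes are followed from the north-west: on the two edges through which they
    enter [c] this is the inverse of [through E c], and all other edges wait. *)
Definition step E c e : edge k n :=
  if e == north c then (if E c then east c else south c)
  else if e == west c then (if E c then south c else east c)
  else e.

Lemma step_id E c e : ~~ enters c e -> step E c e = e.
Proof. by rewrite /step /enters; case: eqP => //=; case: eqP. Qed.

Lemma step_north E c : step E c (north c) = if E c then east c else south c.
Proof. by rewrite /step eqxx. Qed.

Lemma step_west E c : step E c (west c) = if E c then south c else east c.
Proof. by rewrite /step eqxx. Qed.

Lemma step_leaves E c e : enters c e -> leaves c (step E c e).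
Proof.
by case/orP=> /eqP->; rewrite ?step_north ?step_west;
   case: ifP; rewrite ?leaves_east ?leaves_south.
Qed.

Lemma step_inj E c e f : ~~ leaves c e -> ~~ leaves c f ->
  step E c e = step E c f -> e = f.
Proof.
case: (boolP (enters c e)) => he; case: (boolP (enters c f)) => hf.
- move=> _ _; move: he hf => /orP[]/eqP-> /orP[]/eqP->;
  by rewrite ?step_north ?step_west; case: ifP.
- by rewrite (step_id _ hf) => _ /negP + h; rewrite -h => []; case; apply: step_leaves.
- by rewrite (step_id _ he) => /negP + _ h; rewrite h => []; case; apply: step_leaves.
by rewrite !step_id.
Qed.

Lemma step_ext E E' c e : E c = E' c -> step E c e = step E' c e.
Proof. by rewrite /step => ->. Qed.

Lemma through_enters E c f : leaves c f -> enters c (through E c f).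
Proof.
by rewrite /through => /orP[]/eqP->; case: eqP => // _;
   case: ifP; rewrite ?enters_north ?enters_west.
Qed.

Lemma stepK E c e : enters c e -> through E c (step E c e) = e.
Proof.
case/orP=> /eqP->; rewrite ?step_north ?step_west /through;
by case hE: (E c) => /=; rewrite ?eqxx.
Qed.

Lemma throughK E c f : leaves c f -> step E c (through E c f) = f.
Proof.
by rewrite /through => /orP[]/eqP->; rewrite ?eqxx /=; case hE: (E c);
   rewrite ?step_north ?step_west hE.
Qed.

End Grid.

(** * The south-east border of a partition *)

Section Shape.

Variables k n : nat.
Variable la : k.-tuple nat.
Hypothesis hla : in_Lambda n la.
Implicit Types (c : cell k n) (e f : edge k n) (E : filling k n).

Lemma row_le i : tnth la i <= n - k.
Proof. by case/andP: hla => _ /allP; apply; apply: mem_tnth. Qed.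

Lemma row_anti (i j : 'I_k) : i <= j -> tnth la j <= tnth la i.
Proof.
case/andP: hla => hs _ hij; rewrite !(tnth_nth 0).
have tr : transitive geq by move=> a b c /= h1 h2; apply: leq_trans h2 h1.
by apply: (sorted_leq_nth tr leqnn) hij; rewrite ?inE ?size_tuple.
Qed.

(** As the parts decrease, the rows that reach column [j] form an initial
    segment, so that their number determines them. *)
Lemma col_heightP (i : nat) (j : 'I_(n - k)) : i <= k ->
  reflect (forall r : 'I_k, (r < i) = (j < tnth la r))
          (i == #|[set r : 'I_k | j < tnth la r]|).
Proof.
move=> hik; set A := [set _ | _].
have cardI m : m <= k -> #|[set r : 'I_k | r < m]| = m.
  move=> hm; rewrite -[RHS](card_ord m) -(card_image (f := widen_ord hm)).
    apply: eq_card => r; rewrite !inE; apply/idP/imageP => [hr|[x _ ->]] //=.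
    by exists (Ordinal hr) => //; apply: val_inj.
  by move=> x y [] /val_inj.
apply: (iffP eqP) => [hi r|h]; last first.
  by rewrite -(cardI i hik); apply: eq_card => r; rewrite !inE h.
have hsub (m : nat) : m <= k -> (forall r : 'I_k, r < m -> j < tnth la r) -> m <= i.
  move=> hm h; rewrite hi -(cardI m hm); apply/subset_leq_card/subsetP => x.
  by rewrite !inE => /h.
apply/idP/idP=> [hr|hr].
- rewrite ltnNge; apply/negP=> hj; move: hr; rewrite ltnNge => /negP; apply.
  rewrite hi -(cardI r (ltnW (ltn_ord r))); apply/subset_leq_card/subsetP => x.
  rewrite !inE => hx; rewrite ltnNge; apply/negP=> /row_anti hrx.
  by move: (leq_trans hx (leq_trans hrx hj)); rewrite ltnn.
- apply: hsub => // x hx; apply: leq_trans hr _; exact: row_anti.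
Qed.

Lemma se_edge_exits c e : in_shape la c -> se_edge la e -> ~~ enters c e.
Proof.
move=> hc he; apply/negP=> /orP[]/eqP h; move: he; rewrite h /=.
  move/(col_heightP _ (ltnW (ltn_ord c.1)))/(_ c.1).
  by rewrite ltnn => /esym/negP; apply.
by move=> /eqP h'; move: hc; rewrite /in_shape -h' ltnn.
Qed.

(** The edges of the diagram together with those of the north-west border, that
    is, the edges visited by some pipe. *)
Definition inside e :=
  (e \in nw_border k n) || [exists c, in_shape la c && leaves c e].

Lemma insideP e : reflect
  (e \in nw_border k n \/ exists2 c, in_shape la c & leaves c e) (inside e).
Proof.
apply: (iffP orP) => [] [h|]; try by left.
  by case/existsP=> c /andP[]; right; exists c.
by case=> c h1 h2; right; apply/existsP; exists c; rewrite h1.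
Qed.

Lemma inside_nw e : e \in nw_border k n -> inside e.
Proof. by rewrite /inside => ->. Qed.

Lemma inside_leaves c e : in_shape la c -> leaves c e -> inside e.
Proof. by move=> h1 h2; apply/insideP; right; exists c. Qed.

(** If an edge visited by some pipe leads to no further cell, the cells of its row
    or column stop there. *)
Lemma inside_se e : inside e ->
  (forall c, in_shape la c -> ~~ enters c e) -> se_edge la e.
Proof.
case: e => [[i j]|[i j]] hin hout /=.
- apply/col_heightP; first by rewrite -ltnS.
  move=> r; apply/idP/idP=> [hr|hr].
    case/insideP: hin => [/nw_borderP[] [] // x [hi _]|[c hc]].
      by move: hr; rewrite hi.
    case/orP=> /eqP // [hi hj]; apply: leq_trans (row_anti (j := c.1) _).
      by rewrite hj.
    by move: hr; rewrite hi /= /bump leq0n.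
  rewrite ltnNge; apply/negP => hir.
  have hik : i < k by apply: leq_ltn_trans hir _.
  have /negP[] := hout (Ordinal hik, j) (leq_trans hr (row_anti (i := Ordinal hik) hir)).
  by rewrite /enters; apply/orP; left; apply/eqP; congr inl; congr pair; apply: val_inj.
apply/eqP/anti_leq/andP; split.
  case/insideP: hin => [/nw_borderP[] [] // x [_ ->] //|[c hc]].
  by case/orP=> /eqP // [-> ->]; rewrite /= /bump leq0n.
rewrite leqNgt; apply/negP=> hj.
have hjm : j < n - k by apply: leq_trans hj (row_le _).
have /negP[] := hout (i, Ordinal hjm) hj.
by rewrite /enters; apply/orP; right; apply/eqP; congr inr; congr pair; apply: val_inj.
Qed.

Lemma inside_enters c e : in_shape la c -> enters c e -> inside e.
Proof.
case: c => i j hc /orP[]/eqP->.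
  case: i hc => [[|i] hi] hc.
    by apply/inside_nw/nw_borderP; left; exists j; congr inl; congr pair; apply: val_inj.
  apply: (@inside_leaves (Ordinal (ltnW hi), j)).
    by apply: leq_trans hc (row_anti _).
  by rewrite /leaves; apply/orP; right; apply/eqP; congr inl; congr pair; apply: val_inj.
case: j hc => [[|j] hj] hc.
  by apply/inside_nw/nw_borderP; right; exists i; congr inr; congr pair; apply: val_inj.
apply: (@inside_leaves (i, Ordinal (ltnW hj))).
  by apply: ltnW hc.
by rewrite /leaves; apply/orP; left; apply/eqP; congr inr; congr pair; apply: val_inj.
Qed.

(** Along the south-east border each unit step, west or south, adds one to the
    distance from the north-east corner. *)
Lemma edge_pos_inj e f : se_edge la e -> se_edge la f ->
  edge_pos e = edge_pos f -> e = f.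
Proof.
have hk (i : 'I_k.+1) : i <= k by rewrite -ltnS.
have mixed (i : 'I_k.+1) (j : 'I_(n - k)) (r : 'I_k) (a : 'I_(n - k).+1) :
    se_edge la (inl (i, j) : edge k n) -> se_edge la (inr (r, a) : edge k n) ->
    edge_pos (inl (i, j) : edge k n) <> edge_pos (inr (r, a) : edge k n).
  move=> /(col_heightP _ (hk i)) hi /eqP ha /=; case: (ltnP r i) => hri.
    have hja : j < a by rewrite ha -hi.
    apply/eqP; rewrite neq_ltn; apply/orP; right.
    by rewrite -addSn leq_add // leq_sub2l.
  have haj : a <= j by rewrite leqNgt ha -hi -leqNgt.
  apply/eqP; rewrite neq_ltn; apply/orP; left.
  by rewrite -addnS leq_add // ltn_sub2l // (leq_ltn_trans haj).
case: e f => [[i j]|[r a]] [[i' j']|[r' a']] he hf.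
- wlog hjj : i j i' j' he hf / j <= j'.
    move=> h heq; case: (leqP j j') => hj; first exact: (h _ _ _ _ he hf).
    by apply/esym/h; rewrite // ltnW.
  move/(col_heightP _ (hk i)): he => hi; move/(col_heightP _ (hk i')): hf => hi' /= heq.
  have hii : i' <= i.
    rewrite leqNgt; apply/negP=> hii.
    have hik : i < k by apply: leq_trans hii (hk _).
    have := hi' (Ordinal hik); rewrite /= hii => /esym.
    by move/(leq_ltn_trans hjj); rewrite -hi /= ltnn.
  have hj : j = j'.
    apply/val_inj/anti_leq; rewrite hjj /= leqNgt; apply/negP=> hj.
    suff : i' + (n - k - j'.+1) < i + (n - k - j.+1) by rewrite heq ltnn.
    by rewrite -addnS leq_add // ltn_sub2l // (leq_ltn_trans hj).
  by move: heq; rewrite hj => /addIn/val_inj->.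
- by move/(mixed _ _ _ _ he hf).
- by move/esym/(mixed _ _ _ _ hf he).
- wlog hrr : r a r' a' he hf / r <= r'.
    move=> h heq; case: (leqP r r') => hr; first exact: (h _ _ _ _ he hf).
    by apply/esym/h; rewrite // ltnW.
  move/eqP: he => /= he; move/eqP: hf => /= hf heq.
  have haa : a' <= a by rewrite he hf row_anti.
  have hr : r = r'.
    apply/val_inj/anti_leq; rewrite hrr /= leqNgt; apply/negP=> hr.
    suff : r + (n - k - a) < r' + (n - k - a') by rewrite heq ltnn.
    by rewrite -addSn leq_add // leq_sub2l.
  by congr inr; rewrite hr; congr pair; apply: val_inj; rewrite /= he hf hr.
Qed.

End Shape.

(** * Pipes followed from the north-west *)

Section Pipes.

Variables k n : nat.
Hypothesis hkn : k <= n.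
Variable la : k.-tuple nat.
Hypothesis hla : in_Lambda n la.
Implicit Types (c p : cell k n) (e f x : edge k n) (E : filling k n).
Implicit Types (s q : seq (cell k n)).

(** Crossing the cells by increasing rank, every pipe that comes from the
    north-west meets its cells in the order of the list. *)
Definition cells : seq (cell k n) :=
  sort (relpre (@cell_rank k n) leq) (enum [pred c | in_shape la c]).

Lemma mem_cells c : (c \in cells) = in_shape la c.
Proof. by rewrite mem_sort mem_enum. Qed.

Lemma cells_uniq : uniq cells.
Proof. by rewrite sort_uniq enum_uniq. Qed.

Lemma cells_split c : in_shape la c -> exists q s, cells = q ++ c :: s.
Proof. by rewrite -mem_cells => /path.splitPr[q s]; exists q, s. Qed.

Section Split.

Variables (q s : seq (cell k n)) (c : cell k n).
Hypothesis hcs : cells = q ++ c :: s.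

Lemma split_shape : in_shape la c.
Proof. by rewrite -mem_cells hcs mem_cat mem_head orbT. Qed.

Lemma split_uniq : [/\ c \notin q, c \notin s & forall c', c' \in q -> c' \notin s].
Proof.
have := cells_uniq; rewrite hcs cat_uniq /= negb_or -!andbA.
case/and5P=> _ hcq /hasPn hqs hcs' _; split=> // c' hc'.
by apply/negP=> /hqs /=; rewrite hc'.
Qed.

Lemma split_rank :
  (forall c', c' \in q -> cell_rank c' <= cell_rank c) /\
  (forall c', c' \in s -> cell_rank c <= cell_rank c').
Proof.
have tr : transitive (relpre (@cell_rank k n) leq).
  by move=> c1 c2 c3 /=; apply: leq_trans.
have : sorted (relpre (@cell_rank k n) leq) cells.
  by apply: sort_sorted => c1 c2 /=; apply: leq_total.
rewrite (sorted_pairwise tr) hcs pairwise_cat /= => /and3P[hq _ /andP[hs _]].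
split=> c' hc'; last by move/allP: hs => /(_ _ hc').
by move: hq; rewrite allrel_consr => /andP[/allP/(_ _ hc')].
Qed.

Lemma split_after c' :
  in_shape la c' -> cell_rank c < cell_rank c' -> c' \in s.
Proof.
rewrite -mem_cells hcs mem_cat inE => /or3P[] // => [/(proj1 split_rank)|/eqP->].
  by rewrite leqNgt => /negPf->.
by rewrite ltnn.
Qed.

End Split.

Definition run E e s : edge k n := foldl (fun f c => step E c f) e s.

Lemma run_cons E e c s : run E e (c :: s) = run E (step E c e) s.
Proof. by []. Qed.

Lemma run_cat E e q s : run E e (q ++ s) = run E (run E e q) s.
Proof. exact: foldl_cat. Qed.

Lemma run_ext E E' e s : {in s, E =1 E'} -> run E e s = run E' e s.
Proof.
elim: s e => //= c s IH e h; rewrite (step_ext e (h c (mem_head _ _))).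
by apply: IH => c' hc'; apply: h; rewrite inE hc' orbT.
Qed.

Lemma run_id E e s : (forall c, c \in s -> ~~ enters c e) -> run E e s = e.
Proof.
elim: s => //= c s IH h; rewrite step_id ?h ?mem_head //.
by apply: IH => c' hc'; apply: h; rewrite inE hc' orbT.
Qed.

(** Let [s] be a final segment of [cells].  Inside the diagram, its front is the
    lattice path that separates the cells of [s] from those already crossed;
    [ahead] alone also admits the edges beyond that path. *)
Definition ahead s e := forall c, in_shape la c -> enters c e -> c \in s.
Definition front s e := ahead s e /\ (forall c, c \in s -> ~~ leaves c e).

Lemma ahead_cells e : ahead cells e.
Proof. by move=> c hc _; rewrite mem_cells. Qed.

Lemma front_nw e : e \in nw_border k n -> front cells e.
Proof.
by move=> he; split=> [|c _]; [apply: ahead_cells | apply: nw_border_leaves].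
Qed.

Lemma ahead_step q c s E e : cells = q ++ c :: s ->
  ahead (c :: s) e -> ahead s (step E c e).
Proof.
move=> hcs ha c' hc'; case: (boolP (enters c e)) => hce.
  move/(leaves_enters_rank (step_leaves E hce)) => hr.
  by apply: (split_after hcs hc'); rewrite hr.
rewrite step_id // => hc'e; have := ha _ hc' hc'e; rewrite inE => /orP[/eqP h|//].
by move: hce; rewrite -h hc'e.
Qed.

Lemma front_step q c s E e : cells = q ++ c :: s ->
  front (c :: s) e -> front s (step E c e).
Proof.
move=> hcs [ha hf]; split=> [|c' hc']; first exact: ahead_step hcs ha.
have [_ hcs' _] := split_uniq hcs.
case: (boolP (enters c e)) => hce.
  apply/negP=> /(leaves_inj (step_leaves E hce)) h.
  by move: hcs'; rewrite h hc'.
by rewrite step_id // hf // inE hc' orbT.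
Qed.

Lemma front_enters q c s e : cells = q ++ c :: s -> enters c e ->
  front (c :: s) e.
Proof.
move=> hcs he; split=> [c' _ he'|c' hc'].
  by rewrite (enters_inj he' he) mem_head.
apply/negP=> /leaves_enters_rank /(_ he) hr.
move: hc'; rewrite inE => /orP[/eqP h|/(proj2 (split_rank hcs))].
  by move: hr; rewrite h => /n_Sn.
by rewrite hr ltnn.
Qed.

Lemma front_run q s r E e : cells = q ++ s ++ r -> front (s ++ r) e ->
  front r (run E e s).
Proof.
elim: s q e => //= c s IH q e hcs hf; apply: (IH (rcons q c)).
  by rewrite cat_rcons.
exact: front_step hcs hf.
Qed.

(** Two pipes cannot merge: a cell permutes the edges of the front, and an edge
    that it leads to was not on the front before. *)
Lemma run_inj q s E e f : cells = q ++ s -> front s e -> front s f ->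
  run E e s = run E f s -> e = f.
Proof.
elim: s q e f => //= c s IH q e f hcs he hf.
move/(IH (rcons q c) _ _); rewrite cat_rcons => /(_ hcs) h.
apply: (step_inj (E := E) (c := c)).
- by apply: (proj2 he); rewrite mem_head.
- by apply: (proj2 hf); rewrite mem_head.
by apply: h; apply: front_step hcs _.
Qed.

Definition endpt E e : edge k n := run E e cells.

(** The cells before [c] do not move an edge entering [c]. *)
Lemma endpt_split q c s E e : cells = q ++ c :: s -> enters c e ->
  endpt E e = run E (step E c e) s.
Proof.
move=> hcs he; rewrite /endpt hcs run_cat run_cons (_ : run E e q = e) //.
apply: run_id => c' hc'; apply/negP=> /(enters_inj he) h.
by have [hcq _ _] := split_uniq hcs; move: hcq; rewrite h hc'.
Qed.

Lemma endpt_step E c e : in_shape la c -> enters c e ->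
  endpt E (step E c e) = endpt E e.
Proof.
move=> hc he; have [q [s hcs]] := cells_split hc.
rewrite (endpt_split E hcs he) /endpt hcs run_cat run_cons.
have hl := step_leaves E he.
have hr c' : enters c' (step E c e) -> cell_rank c < cell_rank c'.
  by move/(leaves_enters_rank hl) => ->.
rewrite (_ : run E (step E c e) q = step E c e).
  by rewrite [step _ _ (step _ _ _)]step_id //; apply/negP=> /hr; rewrite ltnn.
apply: run_id => c' hc'.
by apply/negP=> /hr; rewrite ltnNge (proj1 (split_rank hcs)).
Qed.

Lemma endpt_through E c f : in_shape la c -> leaves c f ->
  endpt E (through E c f) = endpt E f.
Proof. by move=> hc hf; rewrite -(endpt_step _ hc (through_enters E hf)) throughK. Qed.

Lemma endpt_id E e : se_edge la e -> endpt E e = e.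
Proof.
by move=> he; apply: run_id => c; rewrite mem_cells => hc; apply: se_edge_exits hc he.
Qed.

Lemma inside_step E c e : in_shape la c -> inside la e -> inside la (step E c e).
Proof.
move=> hc he; case: (boolP (enters c e)) => h; last by rewrite step_id.
exact: inside_leaves hc (step_leaves E h).
Qed.

Lemma endpt_se E e : inside la e -> se_edge la (endpt E e).
Proof.
move=> he; suff [hi ha] : inside la (endpt E e) /\ ahead [::] (endpt E e).
  by apply: inside_se => // c hc; apply/negP=> /(ha c hc).
have : exists q, cells = q ++ cells by exists [::].
have := @ahead_cells e.
rewrite /endpt; elim: {1 3 4 5}cells e he => [|c s IH] e he ha [q hcs] //.
apply: IH.
- exact: inside_step (split_shape hcs) he.
- exact: ahead_step hcs ha.
by exists (rcons q c); rewrite cat_rcons.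
Qed.

Lemma inside_ind E (P : edge k n -> Prop) :
  (forall e, e \in nw_border k n -> P e) ->
  (forall c e, in_shape la c -> leaves c e -> P (through E c e) -> P e) ->
  forall e, inside la e -> P e.
Proof.
move=> h0 h1 e; move: {2}(rank e).+1 (ltnSn (rank e)) => N.
elim: N e => // N IH e hN /insideP[|[c hc hl]]; first exact: h0.
apply: (h1 c) => //; have ht := through_enters E hl.
apply: IH; last exact: inside_enters ht.
by move: hN; rewrite (leaves_rank hl) (enters_rank ht).
Qed.

Lemma advance_leaves E c f : in_shape la c -> leaves c f ->
  advance la E f = through E c f.
Proof.
move=> hc hf; rewrite /advance; case: pickP => [c' /andP[_ hf']|/(_ c)].
  by rewrite (leaves_inj hf hf').
by rewrite hc -/(leaves c f) hf.
Qed.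

Lemma endpt_advance E f : endpt E (advance la E f) = endpt E f.
Proof.
by rewrite /advance; case: pickP => // c /andP[hc hf]; apply: endpt_through.
Qed.

(** Each step raises the rank by one, and ranks are smaller than [n]; this is why
    the [n] edges listed by [pipe] are the whole pipe. *)
Lemma run_retrace E e s : {subset s <= in_shape la} ->
  exists2 j, e = iter j (advance la E) (run E e s) &
             rank (run E e s) = j + rank e.
Proof.
elim: s e => [|c s IH] e hs; first by exists 0.
have hs' : {subset s <= in_shape la} by move=> c' h; apply: hs; rewrite inE h orbT.
have [j hj hr] := IH (step E c e) hs'; rewrite run_cons.
case: (boolP (enters c e)) => he; last first.
  by exists j; move: hj hr; rewrite step_id.
have hl := step_leaves E he; exists j.+1.
  by rewrite iterS -hj (advance_leaves _ (hs c (mem_head _ _)) hl) stepK.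
by rewrite hr (leaves_rank hl) (enters_rank he) addnS.
Qed.

(** The end of a pipe does not change along [advance], so an edge lies on the
    pipe of its own end only, and going back from there reaches it. *)
Lemma label_endpt E e : inside la e -> label la E e = edge_pos (endpt E e).
Proof.
move=> he; rewrite /label; case: pickP => [e0 /andP[he0]|].
  case/trajectP=> j _ ->; congr edge_pos.
  suff -> : endpt E (iter j (advance la E) e0) = endpt E e0 by rewrite endpt_id.
  by elim: j => //= j IH; rewrite endpt_advance.
move=> /(_ (endpt E e)); rewrite endpt_se //= => /negP[]; apply/trajectP.
have [|j hj hr] := @run_retrace E e cells; first by move=> c; rewrite mem_cells.
exists j => //; apply: leq_trans (rank_lt (endpt E e) hkn).
by rewrite ltnS /endpt hr leq_addr.
Qed.

Lemma label_inj E e f : inside la e -> inside la f ->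
  (label la E e == label la E f) = (endpt E e == endpt E f).
Proof.
move=> he hf; rewrite !label_endpt //; apply/eqP/eqP=> [|->] //.
by apply: (edge_pos_inj hla); apply: endpt_se.
Qed.

Lemma endpt_nw_inj E x y : x \in nw_border k n -> y \in nw_border k n ->
  endpt E x = endpt E y -> x = y.
Proof. by move=> /front_nw hx /front_nw hy; apply: (run_inj (q := [::])). Qed.

Lemma endpt_north_west E c : in_shape la c -> endpt E (north c) <> endpt E (west c).
Proof.
move=> hc; have [q [s hcs]] := cells_split hc.
have he := enters_north c; have hf := enters_west c.
rewrite (endpt_split E hcs he) (endpt_split E hcs hf) -!run_cons => h.
have := run_inj hcs (front_enters hcs he) (front_enters hcs hf) h.
by [].
Qed.

Lemma exit_exists E e : inside la e ->
  exists2 x, x \in nw_border k n & endpt E x = endpt E e.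
Proof.
move: e; apply: (inside_ind (E := E)) => [e he|c e hc hl [x hx h]]; first by exists e.
by exists x; rewrite // h endpt_through.
Qed.

(** From the edges of [p] on, a pipe visits only cells south-east of [p].  The
    labels entering a cell therefore survive toggles elsewhere. *)
Lemma endpt_local E E' p e :
  (forall c, in_shape la c -> prec c p -> E c = E' c) ->
  (forall c, in_shape la c -> enters c e -> prec c p) ->
  endpt E e = endpt E' e.
Proof.
move=> hE; rewrite /endpt.
have : {subset cells <= in_shape la} by move=> c; rewrite mem_cells.
elim: cells e => //= c s IH e hs he.
have hc : in_shape la c by apply: hs; rewrite mem_head.
have hs' : {subset s <= in_shape la} by move=> c' h; apply: hs; rewrite inE h orbT.
case: (boolP (enters c e)) => hce; last by rewrite !step_id //; apply: IH.
have hcp := he c hc hce.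
rewrite -(step_ext e (hE c hc hcp)); apply: IH => // c' _.
by move/(leaves_enters_prec (step_leaves E hce)) => h; apply: prec_trans h hcp.
Qed.

(** Going back from a cell to the north-west border, a pipe visits only cells
    north-west of it.  Ends of pipes may well differ in [E] and [E']; what is
    kept is which source [x] the pipe of [e] comes from. *)
Lemma exit_local E E' p x : x \in nw_border k n ->
  (forall c, in_shape la c -> prec p c -> cell_rank c < cell_rank p -> E c = E' c) ->
  forall e, enters p e -> in_shape la p ->
  endpt E x = endpt E e -> endpt E' x = endpt E' e.
Proof.
move=> hx hE e he hp.
have : forall c, leaves c e -> prec p c /\ cell_rank c < cell_rank p.
  by move=> c hl; rewrite (leaves_enters_prec hl he) (leaves_enters_rank hl he).
have := inside_enters hla hp he; move: e {he}.
apply: (inside_ind (E := E)) => [e he _ /(endpt_nw_inj hx he) -> //|c e hc hl IH hin].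
rewrite -!(endpt_through _ hc hl).
have [hpc hr] := hin c hl.
have <- : through E c e = through E' c e by rewrite /through hE.
apply: IH => c' hl'; have ht := through_enters E hl; split.
  exact: prec_trans hpc (leaves_enters_prec hl' ht).
by apply: ltn_trans hr; rewrite (leaves_enters_rank hl' ht).
Qed.

(** Up to [p] nothing changes, at [p] the two pipes change places, and from there
    on each follows the track of the other. *)
Lemma endpt_toggle E p x : in_shape la p -> x \in nw_border k n ->
  endpt (toggle E p) x =
    if endpt E x == endpt E (north p) then endpt E (west p)
    else if endpt E x == endpt E (west p) then endpt E (north p)
    else endpt E x.
Proof.
move=> hp hx; have [q [s hcs]] := cells_split hp.
have [hpq hps _] := split_uniq hcs.
have tE c : c != p -> toggle E p c = E c by rewrite /toggle ffunE => /negPf->.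
have runq : run (toggle E p) x q = run E x q.
  by apply: run_ext => c hc; apply: tE; apply: contraNneq hpq => <-.
have runs f : run (toggle E p) f s = run E f s.
  by apply: run_ext => c hc; apply: tE; apply: contraNneq hps => <-.
have hy : front (p :: s) (run E x q).
  by apply: (front_run (q := [::])) => //; rewrite -hcs; apply: front_nw.
have cmp f : enters p f -> (endpt E x == endpt E f) = (run E x q == f).
  move=> hf; rewrite (endpt_split E hcs hf) /endpt hcs run_cat -run_cons.
  apply/eqP/eqP=> [|->] //; apply: run_inj hcs hy (front_enters hcs hf).
rewrite !cmp ?enters_north ?enters_west //.
rewrite !(endpt_split _ hcs (enters_north _)) !(endpt_split _ hcs (enters_west _)).
rewrite {1}/endpt hcs run_cat run_cons runq runs.
have tp : toggle E p p = ~~ E p by rewrite ffunE eqxx.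
case: eqP => [->|/eqP hN]; first by rewrite !step_north !step_west tp; case: (E p).
case: eqP => [->|/eqP hW]; first by rewrite !step_north !step_west tp; case: (E p).
by rewrite /endpt hcs run_cat run_cons !step_id // /enters negb_or hN.
Qed.

End Pipes.
(** Moving both positions of an inversion by the transposition of [x] and [y]
    when this keeps them in order, and leaving the pair alone otherwise, injects
    the inversions of [w] into those of [w'] other than the new one, [(x, y)]. *)
Lemma perm_length_swap (w w' : seq nat) (x y : nat) :
  size w = size w' -> x < y < size w ->
  nth 0 w' x = nth 0 w y -> nth 0 w' y = nth 0 w x ->
  (forall z, z != x -> z != y -> nth 0 w' z = nth 0 w z) ->
  nth 0 w x < nth 0 w y ->
  perm_length w < perm_length w'.
Proof.
move=> hs hxy; rewrite /perm_length -{}hs; move: (size w) hxy => N.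
case/andP=> hxy hyN hx hy hz hlt.
have hxN := ltn_trans hxy hyN.
pose X : 'I_N := Ordinal hxN; pose Y : 'I_N := Ordinal hyN.
have hXY : X != Y by rewrite -(inj_eq val_inj) /= ltn_eqF.
pose sg := tperm X Y.
have hw (a : 'I_N) : nth 0 w' (sg a) = nth 0 w a.
  rewrite /sg; case: tpermP => [->|->|/eqP ha /eqP hb] //=.
  by apply: hz; rewrite -?[x]/(val X) -?[y]/(val Y) (inj_eq val_inj).
have hw' (a : 'I_N) : nth 0 w' a = nth 0 w (sg a) by rewrite -hw tpermK.
set A := [set _ | _]; set B := [set _ | _].
pose phi (ab : 'I_N * 'I_N) :=
  if sg ab.1 < sg ab.2 then (sg ab.1, sg ab.2) else ab.
have XYB : (X, Y) \in B by rewrite inE /= hxy hx hy.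
rewrite (cardsD1 (X, Y) B) XYB add1n ltnS.
have phi_inj : {in A &, injective phi}.
  move=> [a b] [c d]; rewrite !inE /= => /andP[hab _] /andP[hcd _].
  rewrite /phi /=; case: ltnP => h1; case: ltnP => h2 [] h3 h4.
  - by rewrite (perm_inj h3) (perm_inj h4).
  - by move: h2; rewrite -h3 -h4 !tpermK leqNgt hab.
  - by move: h1; rewrite h3 h4 !tpermK leqNgt hcd.
  - by rewrite h3 h4.
rewrite -(card_in_imset phi_inj); apply/subset_leq_card/subsetP => _ /imsetP[[a b] hab ->].
move: hab; rewrite !inE /phi /= => /andP[hab hinv]; case: ltnP => hsg /=.
  rewrite hsg !hw hinv !andbT xpair_eqE; apply/negP=> /andP[/eqP h1 /eqP h2].
  have ha : a = Y by rewrite -[a](tpermK X Y) -/sg h1 /sg tpermL.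
  have hb : b = X by rewrite -[b](tpermK X Y) -/sg h2 /sg tpermR.
  by move: hab; rewrite ha hb /= ltnNge ltnW.
rewrite hab /= !hw' xpair_eqE; apply/andP; split.
  apply/negP=> /andP[/eqP ha /eqP hb]; move: hinv.
  by rewrite ha hb /= ltnNge ltnW.
move: hsg; rewrite leq_eqVlt => /orP[/eqP/val_inj/perm_inj h|].
  by move: hab; rewrite h ltnn.
rewrite /sg; case: tpermP => [hb|hb|_ _]; case: tpermP => [ha|ha|_ _] //=.
all: rewrite ?ha ?hb /= in hab hinv *.
all: try by rewrite ?ltnn in hab.
all: try by move=> h; move: (ltn_trans hab h); rewrite ?ltnn.
- by rewrite ltnNge ltnW in hab.
- by move=> h; move: (ltn_trans hxy (ltn_trans h hab)); rewrite ltnn.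
- by move=> _; apply: ltn_trans hlt hinv.
- by move=> _; apply: ltn_trans hinv hlt.
by move=> h; move: (ltn_trans hxy (ltn_trans hab h)); rewrite ltnn.
Qed.

(** * Restricted diagrams as sets of toggled cells *)

Lemma perm_eq2 (T : eqType) (x y a b : T) : perm_eq [:: x; y] [:: a; b] ->
  (x = a /\ y = b) \/ (x = b /\ y = a).
Proof.
move=> h; have := perm_mem h x; rewrite !inE eqxx => /esym/orP[]/eqP hx.
  by move: h; rewrite hx perm_cons => /perm_mem/(_ y); rewrite !inE eqxx => /esym/eqP; left.
move: h; rewrite hx (perm_sym [:: b; y]) (perm_catC [:: a] [:: b]) perm_cons.
by move=> /perm_mem/(_ y); rewrite !inE eqxx => /eqP; right.
Qed.

Section Restricted.

Variables k n : nat.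
Hypothesis hkn : k <= n.
Variable la : k.-tuple nat.
Hypothesis hla : in_Lambda n la.
Variable D : filling k n.
Hypothesis hD : Go_diagram la D.
Implicit Types (c p : cell k n) (e f x : edge k n) (E : filling k n).
Implicit Types (T : {set cell k n}).

Definition toggled T : filling k n := [ffun c => D c (+) (c \in T)].

(** The pipe of [e] ends on the west boundary.  Pipes are compared by their
    south-east ends, which are easier to control than their exits. *)
Definition west_bound E e :=
  [exists i, endpt la E (west_edge n i) == endpt la E e].

(** A jump at [p] then moves the path of a west boundary source onto a pipe that
    carries no other west boundary source. *)
Definition jumpable E p := west_bound E (west p) && ~~ west_bound E (north p).

(** Every toggle is tested in the final diagram [toggled T], instead of the
    diagram in which it was made; by [jumpable_local] this is the same. *)
Definition admissible T :=
  [forall p in T, [&& in_shape la p, ~~ white la D p & jumpable (toggled T) p]].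

Lemma west_edge_nw i : west_edge n i \in nw_border k n.
Proof. by apply/nw_borderP; right; exists i. Qed.

Lemma north_edge_nw (j : 'I_(n - k)) : north_edge j \in nw_border k n.
Proof. by apply/nw_borderP; left; exists j. Qed.

Lemma west_bound_local E E' p e : in_shape la p -> enters p e ->
  (forall c, in_shape la c -> prec p c -> cell_rank c < cell_rank p -> E c = E' c) ->
  west_bound E e = west_bound E' e.
Proof.
move=> hp he hE; apply/existsP/existsP=> [] [i /eqP h]; exists i; apply/eqP.
  exact: (exit_local hla (west_edge_nw i) hE he hp h).
apply: (exit_local hla (west_edge_nw i) _ he hp h) => c h1 h2 h3.
by rewrite hE.
Qed.

Lemma jumpable_local T T' p : in_shape la p ->
  (forall c, prec p c -> cell_rank c < cell_rank p -> (c \in T) = (c \in T')) ->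
  jumpable (toggled T) p = jumpable (toggled T') p.
Proof.
move=> hp hT; have hE c : in_shape la c -> prec p c ->
    cell_rank c < cell_rank p -> toggled T c = toggled T' c.
  by move=> _ h1 h2; rewrite !ffunE hT.
rewrite /jumpable (west_bound_local hp (enters_west p) hE).
by rewrite (west_bound_local hp (enters_north p) hE).
Qed.

Lemma toggle_toggled T p : p \notin T -> toggle (toggled T) p = toggled (p |: T).
Proof.
move=> hp; apply/ffunP=> c; rewrite !ffunE in_setU1.
by case: eqP => [->|//]; rewrite (negPf hp); case: (D p).
Qed.

Lemma toggled0 : toggled set0 = D.
Proof. by apply/ffunP=> c; rewrite ffunE inE addbF. Qed.

(** Every pipe ends on one of the two boundaries, and on one only. *)
Lemma west_bound_north E e : inside la e ->
  ~~ west_bound E e = [exists j : 'I_(n - k), endpt la E (north_edge j) == endpt la E e].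
Proof.
move=> he; apply/idP/existsP=> [hW|[j /eqP hj]].
  have [x /nw_borderP[[j ->]|[i ->]] hx] := exit_exists hla E he.
    by exists j; apply/eqP.
  by case/negP: hW; apply/existsP; exists i; apply/eqP.
apply/negP=> /existsP[i /eqP hi].
by have := endpt_nw_inj (west_edge_nw i) (north_edge_nw j) (etrans hi (esym hj)).
Qed.

Lemma label_nw E x : x \in nw_border k n -> label la E x = edge_pos (endpt la E x).
Proof. by move/inside_nw => h; apply: label_endpt. Qed.

Lemma nth_dream_perm E x : x \in nw_border k n ->
  nth 0 (dream_perm la E) (index x (nw_border k n)) = label la E x.
Proof. by move=> hx; rewrite (nth_map x) ?index_mem // nth_index. Qed.

Lemma index_north_west (i : 'I_k) (j : 'I_(n - k)) :
  index (north_edge j) (nw_border k n) < index (west_edge n i) (nw_border k n).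
Proof.
rewrite /nw_border !index_cat.
have hj : (north_edge j : edge k n) \in
    [seq north_edge j | j <- rev (enum 'I_(n - k))].
  by apply: map_f; rewrite mem_rev mem_enum.
rewrite hj ifN; last by apply/negP=> /mapP[].
by apply: ltn_addr; rewrite index_mem.
Qed.

Lemma pos_north_west E p : in_shape la p ->
  edge_pos (endpt la E (north p)) != edge_pos (endpt la E (west p)).
Proof.
move=> hp; apply/eqP=> /(edge_pos_inj hla) h; apply: (endpt_north_west hp); apply: h.
  by apply: endpt_se => //; apply: inside_enters hp (enters_north p).
by apply: endpt_se => //; apply: inside_enters hp (enters_west p).
Qed.

(** An elbow sends the pipe of its south edge to the west, a crossing the pipe of
    its east edge.  The former carries the larger label by the Go condition, the
    latter exactly when the stone is not white. *)
Lemma white_pos E p : in_shape la p ->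
  (forall c, in_shape la c -> prec c p -> E c = D c) ->
  white la D p =
    ~~ (edge_pos (endpt la E (north p)) < edge_pos (endpt la E (west p))).
Proof.
move=> hp hE.
have hlab f : leaves p f -> label la D f = edge_pos (endpt la E (through E p f)).
  move=> hf; rewrite label_endpt //; last exact: inside_leaves hp hf.
  rewrite endpt_through //; congr edge_pos.
  apply/esym/(endpt_local hE) => c _; exact: leaves_enters_prec.
have := hD hp; rewrite /white !hlab ?leaves_east ?leaves_south //.
rewrite /through eqxx /= hE ?prec_refl //.
case: (D p) => /=.
  move/(_ isT); rewrite -leqNgt leq_eqVlt (negPf (pos_north_west E hp)) /=.
  by move->.
by move=> _; rewrite -leqNgt [RHS]leq_eqVlt eq_sym (negPf (pos_north_west E hp)).
Qed.

Lemma label_toggle E p x : in_shape la p -> x \in nw_border k n ->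
  label la (toggle E p) x =
    if endpt la E x == endpt la E (north p) then edge_pos (endpt la E (west p))
    else if endpt la E x == endpt la E (west p) then edge_pos (endpt la E (north p))
    else label la E x.
Proof.
move=> hp hx; rewrite !label_nw // endpt_toggle //.
by case: ifP => // _; case: ifP.
Qed.

Lemma perm_length_exchange E E' i (j : 'I_(n - k)) :
  label la E' (west_edge n i) = label la E (north_edge j) ->
  label la E' (north_edge j) = label la E (west_edge n i) ->
  (forall x, x \in nw_border k n -> x != north_edge j -> x != west_edge n i ->
     label la E' x = label la E x) ->
  label la E (north_edge j) < label la E (west_edge n i) ->
  perm_length (dream_perm la E) < perm_length (dream_perm la E').
Proof.
move=> hW hN hx hlt.
have hin := west_edge_nw i; have hjn := north_edge_nw j.
apply: (@perm_length_swap _ _ (index (north_edge j) (nw_border k n))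
   (index (west_edge n i) (nw_border k n))).
- by rewrite !size_map.
- by rewrite index_north_west size_map index_mem.
- by rewrite !nth_dream_perm.
- by rewrite !nth_dream_perm.
- move=> z hz1 hz2; case: (ltnP z (size (nw_border k n))) => hz; last first.
    by rewrite !nth_default ?size_map.
  have hzn := mem_nth (west_edge n i) hz; move: hz1 hz2.
  rewrite -(index_uniq (west_edge n i) hz (nw_border_uniq k n)) !nth_dream_perm //.
  by move=> h1 h2; apply: hx => //; [apply: contraNneq h1 | apply: contraNneq h2] => ->.
by rewrite !nth_dream_perm.
Qed.

(** When nothing is toggled south-east of [p] and [p] holds no white stone, the
    larger label is that of the west edge of [p] by [white_pos].  If its pipe ended
    on the north boundary, toggling [p] would shorten the permutation. *)
Lemma togglableE T p :
  togglable la D (toggled T, T) p =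
  [&& in_shape la p, [forall b in T, ~~ prec b p], ~~ white la D p &
      jumpable (toggled T) p].
Proof.
rewrite /togglable /=; case hp: (in_shape la p) => //=.
case: (boolP [forall b in T, _]) => hT; last by rewrite !andbF.
set E := toggled T; rewrite /=.
have hE c : in_shape la c -> prec c p -> E c = D c.
  move=> _ hc; rewrite /E ffunE; case: (boolP (c \in T)) => h; last by rewrite addbF.
  by move/forall_inP: hT => /(_ c h); rewrite hc.
rewrite (white_pos hp hE) negbK.
set a := edge_pos (endpt la E (north p)); set b := edge_pos (endpt la E (west p)).
have hn := inside_enters hla hp (enters_north p).
have hw := inside_enters hla hp (enters_west p).
have hab : a != b := pos_north_west E hp.
have sn : endpt la E (north p) == endpt la E (west p) = false.
  by apply/eqP; apply: endpt_north_west.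
have hes : perm_eq [:: label la E (east p); label la E (south p)] [:: b; a].
  rewrite !label_endpt ?(inside_leaves hp) ?leaves_east ?leaves_south //.
  rewrite -(endpt_through E hp (leaves_east p)) -(endpt_through E hp (leaves_south p)).
  rewrite /through eqxx /=.
  by case: (E p); rewrite -/a -/b //; apply/permPl/(perm_catC [:: a] [:: b]).
rewrite /jumpable (west_bound_north _ hn).
have ne x y : x \in nw_border k n -> y \in nw_border k n -> x != y ->
    (endpt la E x == endpt la E y) = false.
  by move=> hx hy /eqP hxy; apply/eqP=> /(endpt_nw_inj hx hy).
have lab_inj x f : x \in nw_border k n -> inside la f ->
    label la E x = edge_pos (endpt la E f) -> endpt la E x = endpt la E f.
  move=> hx hf; rewrite label_nw // => /(edge_pos_inj hla); apply;
  by apply: endpt_se => //; apply: inside_nw.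
apply/idP/idP.
  case/and3P=> /existsP[i /existsP[j /and3P[hij _ _]]] hlen hlt; rewrite hlt /=.
  have hin := west_edge_nw i; have hjn := north_edge_nw j.
  have [[hi hj]|[hi hj]] := perm_eq2 (perm_trans hij hes).
    apply/andP; split; apply/existsP; [exists i | exists j]; apply/eqP; exact: lab_inj.
  move/(lab_inj _ _ hin hn): hi => hi; move/(lab_inj _ _ hjn hw): hj => hj.
  (* The opposite exchange: the toggled diagram has the shorter permutation. *)
  move: hlen; rewrite ltnNge ltnW //; apply: (@perm_length_exchange _ _ i j).
  - by rewrite (label_nw E hin) label_toggle // hi hj eq_sym sn eqxx.
  - by rewrite (label_nw E hjn) label_toggle // hi hj eqxx.
  - by move=> x hx hxj hxi; rewrite label_toggle // -hi -hj !ne.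
  by rewrite !label_toggle // hi hj eqxx eq_sym sn eqxx.
case/and3P=> hlt /existsP[i /eqP hi] /existsP[j /eqP hj].
have hin := west_edge_nw i; have hjn := north_edge_nw j.
have hi' : label la (toggle E p) (west_edge n i) = label la E (north_edge j).
  by rewrite label_toggle // (label_nw E hjn) hi hj eq_sym sn eqxx.
have hj' : label la (toggle E p) (north_edge j) = label la E (west_edge n i).
  by rewrite label_toggle // (label_nw E hin) hi hj eqxx.
rewrite hlt !andbT; apply/andP; split.
  apply/existsP; exists i; apply/existsP; exists j.
  rewrite /west_label /north_label hi' hj' !eqxx !andbT.
  by rewrite perm_sym (perm_trans hes) // !label_nw // hi hj.
apply: (perm_length_exchange hi' hj') => [x hx hxj hxi|].
  by rewrite label_toggle // -hi -hj !ne.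
by rewrite !label_nw // hi hj.
Qed.

Lemma admissible_add T p : p \notin T -> {in T, forall b, ~~ prec b p} ->
  admissible (p |: T) =
  [&& admissible T, in_shape la p, ~~ white la D p & jumpable (toggled T) p].
Proof.
move=> hpT hT.
have same c : c != p -> (c \in p |: T) = (c \in T).
  by move=> hc; rewrite in_setU1 (negPf hc).
have jp : in_shape la p -> jumpable (toggled (p |: T)) p = jumpable (toggled T) p.
  move=> hp; apply: jumpable_local => // c _ hr; apply: same.
  by apply: contraTneq hr => ->; rewrite ltnn.
have jT c : c \in T -> in_shape la c ->
    jumpable (toggled (p |: T)) c = jumpable (toggled T) c.
  move=> hc hcs; apply: jumpable_local => // c' hcc' _; apply: same.
  by apply: contraNneq (hT c hc) => <-.
apply/forall_inP/and4P=> [h|[/forall_inP h1 h2 h3 h4] c].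
  have /and3P[h1 h2] := h p (setU11 _ _); rewrite jp // => h3; split=> //.
  apply/forall_inP => c hc; have /and3P[h4 h5] := h c (setU1r _ hc).
  by rewrite jT // h4 h5.
rewrite in_setU1 => /predU1P[->|hc]; first by rewrite h2 h3 jp.
by have /and3P[h5 h6 h7] := h1 c hc; rewrite h5 h6 jT.
Qed.

(** Toggling a further cell does not disturb the earlier ones, as it does not lie
    north-west of them.  Conversely an admissible set can be built up by
    increasing rank: its cell of largest rank is north-west of no other. *)
Lemma restricted_diagramsP X :
  reflect (X.1 = toggled X.2 /\ admissible X.2) (X \in restricted_diagrams la D).
Proof.
rewrite inE; apply: (iffP idP) => [|[]].
  pose reached (Y : marked k n) := Y.1 = toggled Y.2 /\ admissible Y.2.
  have h0 : reached (D, set0).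
    by split; [rewrite toggled0 | apply/forall_inP => c; rewrite inE].
  case/connectP=> q hq ->; rewrite -/(reached _).
  elim: q (D, set0) h0 hq => [//|Y q IH [E T] [/= hE hT]].
  case/andP=> /existsP[p /andP[ht /eqP hY]]; apply: IH.
  move: ht; rewrite hE togglableE => /and4P[hp /forall_inP hin hw hj].
  have hpT : p \notin T by apply: contraL (prec_refl p) => /hin.
  by rewrite hY /reached /= hE toggle_toggled // admissible_add // hT hp hw hj.
case: X => E T /= ->; move: {2}#|T| (erefl #|T|) => N.
elim: N T => [|N IH] T hN hT.
  by move/eqP: hN; rewrite cards_eq0 => /eqP->; rewrite toggled0 connect0.
have /card_gt0P[p0 hp0] : 0 < #|T| by rewrite hN.
case: (@arg_maxnP _ p0 [in T] (@cell_rank k n) hp0) => p /= hp hmax.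
have hT' : {in T :\ p, forall b, ~~ prec b p}.
  move=> b; rewrite !inE => /andP[hbp hb]; apply: contra hbp => hbp.
  by apply/eqP/prec_rank_eq => //; apply: hmax.
have hpT' : p \notin T :\ p by rewrite !inE eqxx.
move: hT; rewrite -{1 2 3}(setD1K hp) admissible_add // => /and4P[h1 h2 h3 h4].
apply: connect_trans (IH (T :\ p) _ h1) _.
  by move: hN; rewrite (cardsD1 p) hp add1n => -[].
apply: connect1; apply/existsP; exists p.
rewrite togglableE h2 h3 h4 toggle_toggled // eqxx !andbT.
exact/forall_inP.
Qed.

End Restricted.

(** * Expansion of a determinant of path weights *)

Lemma sum_subsetsU1 (R : nmodType) (T : finType) (c : T) (A : {set T})
    (P : pred {set T}) (G : {set T} -> R) : c \notin A ->
  (\sum_(X : {set T} | (X \subset c |: A) && P X) G X =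
   \sum_(X : {set T} | (X \subset A) && P X) G X +
   \sum_(X : {set T} | (X \subset A) && P (c |: X)) G (c |: X))%R.
Proof.
move=> hc; rewrite (bigID (fun X : {set T} => c \in X)) /= addrC; congr (_ + _)%R.
  apply: eq_bigl => X; case: (boolP (c \in X)) => hX /=; rewrite ?andbF ?andbT.
    by apply/esym/negP=> /andP[/subsetP/(_ c hX)]; rewrite (negPf hc).
  by rewrite -[in RHS](setU1K hc) subsetD1 hX andbT.
rewrite (reindex_onto (fun X => c |: X) (fun X => X :\ c)) /=; last first.
  by move=> X /andP[_ hX]; rewrite setD1K.
apply: eq_bigl => X; rewrite setU11 andbT.
case: (boolP (c \in X)) => hX.
  have -> : (X \subset A) = false.
    by apply/negP=> /subsetP/(_ c hX); rewrite (negPf hc).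
  rewrite andbC; case: eqP => //= h.
  by have := setD11 c (c |: X); rewrite h hX.
rewrite setU1K // eqxx andbT; congr (_ && _).
by rewrite subUset sub1set setU11 /= -[in RHS](setU1K hc) subsetD1 hX andbT.
Qed.

Section Expansion.

Variables k n : nat.
Hypothesis hkn : k <= n.
Variable la : k.-tuple nat.
Hypothesis hla : in_Lambda n la.
Variable D : filling k n.
Variable F : fieldType.
Variable beta : cell k n -> F.
Hypothesis white0 : forall c, in_shape la c -> white la D c -> beta c = 0%R.
Implicit Types (c p : cell k n) (e : edge k n) (T : {set cell k n}).
Implicit Types (s q : seq (cell k n)) (f : 'I_k -> edge k n).

(** The sum of the weights of the restricted paths from [e] through the cells [s]
    to the sink labelled [t], as [sum_paths] shows: at a west edge the path may
    follow its pipe, or jump to the pipe of the north edge. *)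
Fixpoint path_weight s e (t : nat) : F :=
  if s is c :: s' then
    (path_weight s' (step D c e) t +
     (if e == west c then beta c * path_weight s' (step D c (north c)) t else 0))%R
  else ((edge_pos e == t)%:R)%R.

Definition jump_row f c :=
  [exists i, f i == west c] && ~~ [exists i, f i == north c].

(** Admissibility as a recursion over the cells meets it, [f] being the edges where
    the pipes of the west boundary stand. *)
Fixpoint admissible_run T f s : bool :=
  if s is c :: s' then
    ((c \in T) ==> ~~ white la D c && jump_row f c) &&
    admissible_run T (fun i => step (toggled D T) c (f i)) s'
  else true.

Lemma eq_jump_row f f' c : f =1 f' -> jump_row f c = jump_row f' c.
Proof.
move=> h; rewrite /jump_row; congr (_ && ~~ _);
by apply: eq_existsb => i; rewrite h.
Qed.

Lemma admissible_run_ext T T' f f' s : {in s, forall c, (c \in T) = (c \in T')} ->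
  f =1 f' -> admissible_run T f s = admissible_run T' f' s.
Proof.
elim: s f f' => //= c s IH f f' hT hf.
rewrite (eq_jump_row c hf) hT ?mem_head //; congr (_ && _); apply: IH.
  by move=> c' hc'; apply: hT; rewrite inE hc' orbT.
by move=> i; rewrite hf; apply: step_ext; rewrite !ffunE hT ?mem_head.
Qed.

Variable col : 'I_k -> nat.

Definition path_rows f s : 'M[F]_k := (\matrix_(i, j) path_weight s (f i) (col j))%R.

Definition exit_matrix f : 'M[F]_k := (\matrix_(i, j) (edge_pos (f i) == col j)%:R)%R.

(** Only the row at the west edge of [c] has a jump term.  If another row stands
    at the north edge, the determinant with the jump term has two equal rows;
    otherwise jumping from the west edge amounts to toggling [c], because no row
    stands at the north edge to notice the change.  At a white stone the parameter
    is zero. *)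
Lemma det_path_rows_cons c s f : in_shape la c -> injective f ->
  (\det (path_rows f (c :: s)) =
   \det (path_rows (fun i => step D c (f i)) s) +
   (if ~~ white la D c && jump_row f c
    then beta c * \det (path_rows (fun i => step (toggle D c) c (f i)) s) else 0))%R.
Proof.
move=> hc hf; rewrite /jump_row; case: (boolP [exists i, f i == west c]); last first.
  move=> /existsPn h; rewrite andbF addr0; congr (\det _)%R; apply/matrixP=> i j.
  by rewrite !mxE /= (negPf (h i)) addr0.
case/existsP=> i0 /eqP hi0.
(* The matrix of the jump term, with its row [i0] moved to the north pipe. *)
pose C : 'M[F]_k := (\matrix_(i, j) path_weight s
   (if i == i0 then step D c (north c) else step D c (f i)) (col j))%R.
have other i : i != i0 -> (f i == west c) = false.
  by move=> h; apply/eqP=> hi; case/eqP: h; apply: hf; rewrite hi.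
rewrite (@determinant_multilinear _ _ _ (path_rows (fun i => step D c (f i)) s) C
  i0 1%R (beta c)); first last.
- apply/matrixP=> i j; rewrite !mxE /= eq_sym (negPf (neq_lift _ _)).
  by rewrite (other _ _) ?addr0 // eq_sym neq_lift.
- by apply/matrixP=> i j; rewrite !mxE /= (other _ _) ?addr0 // eq_sym neq_lift.
- by apply/matrixP=> i j; rewrite !mxE /= eqxx hi0 eqxx mul1r.
rewrite mul1r; congr (_ + _)%R.
case: (boolP [exists i, f i == north c]) => [/existsP[i1 /eqP hi1]|/existsPn hN].
  rewrite andbF (@determinant_alternate _ _ C i0 i1) ?mulr0 //.
    by apply/eqP=> h; move: hi0; rewrite h hi1.
  move=> j; rewrite !mxE eqxx hi1; case: eqP => //.
case: (boolP (white la D c)) => hw /=; first by rewrite white0 // mul0r.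
congr (_ * \det _)%R; apply/matrixP=> i j; rewrite !mxE; congr path_weight.
case: eqP => [->|/eqP hi].
  by rewrite hi0 step_north step_west ffunE eqxx; case: (D c).
by rewrite !step_id // /enters (negPf (hN i)) other.
Qed.

(** Repeated splitting: [T] collects the cells where the jump term is taken. *)
Lemma det_path_rows s q f : cells n la = q ++ s -> (forall i, front la s (f i)) ->
  injective f ->
  (\det (path_rows f s) =
   \sum_(T : {set cell k n} | (T \subset [set c in s]) && admissible_run T f s)
     (\prod_(c in T) beta c) * \det (exit_matrix (fun i => run (toggled D T) (f i) s)))%R.
Proof.
elim: s q f => [|c s IH] q f hcs hf finj.
  rewrite (big_pred1 set0) => [|T]; last first.
    by rewrite andbT set_nil subset0.
  by rewrite big_set0 mul1r.
have [hcq hcs' _] := split_uniq hcs; have hc := split_shape hcs.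
have hcA : c \notin [set c' in s] by rewrite inE.
have stepf E : (forall i, front la s (step E c (f i))) /\
               injective (fun i => step E c (f i)).
  split=> [i|i j]; first exact: front_step hcs (hf i).
  have h i' : ~~ leaves c (f i') by apply: (proj2 (hf i')); rewrite mem_head.
  by move/(step_inj (h i) (h j))/finj.
have hcs2 : cells n la = rcons q c ++ s by rewrite cat_rcons.
have IHE E := IH _ (fun i => step E c (f i)) hcs2 (proj1 (stepf E)) (proj2 (stepf E)).
rewrite det_path_rows_cons // set_cons sum_subsetsU1 // (IHE D).
have same T : T \subset [set c' in s] -> c \notin T.
  by move/subsetP=> hT; apply: contra hcA; apply: hT.
congr (_ + _)%R.
  apply: eq_big => [T|T /andP[hT _]].
    case hT : (T \subset _) => //=; rewrite (negPf (same _ hT)) /=.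
    apply: admissible_run_ext => // i; apply: step_ext.
    by rewrite ffunE (negPf (same _ hT)) addbF.
  congr (_ * \det _)%R; apply/matrixP=> i j; rewrite !mxE /=; do 4 congr (_ _).
  by rewrite (step_ext _ (E' := toggled D T)) // ffunE (negPf (same _ hT)) addbF.
have adm T : T \subset [set c' in s] -> admissible_run (c |: T) f (c :: s) =
    (~~ white la D c && jump_row f c) &&
    admissible_run T (fun i => step (toggle D c) c (f i)) s.
  move=> hT /=; rewrite setU11; congr (_ && _); apply: admissible_run_ext.
    by move=> c' hc'; rewrite in_setU1; case: eqP hcs' => // <-; rewrite hc'.
  by move=> i; apply: step_ext; rewrite !ffunE setU11 eqxx addbT.
case: ifP => hj; last first.
  rewrite big_pred0 // => T; case hT : (T \subset _) => //=.
  by have /= -> := adm T hT; rewrite hj.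
rewrite (IHE (toggle D c)) big_distrr /=; apply: eq_big => [T|T /andP[hT _]].
  by case hT : (T \subset _) => //=; have /= -> := adm T hT; rewrite hj.
rewrite big_setU1 ?same //= mulrA; congr (_ * \det _)%R.
apply/matrixP=> i j; rewrite !mxE /=; do 3 congr (_ _).
congr (edge_pos _ == _).
rewrite (step_ext _ (E' := toggled D (c |: T))); last by rewrite !ffunE setU11 eqxx addbT.
apply: run_ext => c' hc'; rewrite !ffunE in_setU1.
by case: eqP hcs' => // <-; rewrite hc'.
Qed.

(** A west boundary pipe stands at an edge of [c] when [c] is about to be crossed
    exactly if both have the same end, because pipes on a front do not merge. *)
Lemma admissible_run_admissible T : {subset T <= in_shape la} ->
  admissible_run T (west_edge n) (cells n la) = admissible la D T.
Proof.
move=> hT; set E := toggled D T.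
have gen s q f : cells n la = q ++ s -> (forall i, front la s (f i)) ->
    (forall i, run E (f i) s = endpt la E (west_edge n i)) ->
    admissible_run T f s =
    [forall p in T, (p \in s) ==> ~~ white la D p && jumpable la E p].
  elim: s q f => [|c s IH] q f hcs hf hrun /=.
    by apply/esym/forall_inP.
  have bound e : enters c e ->
      [exists i, f i == e] = west_bound la E e.
    move=> he; apply: eq_existsb => i; rewrite -hrun (endpt_split _ hcs he) -run_cons.
    apply/eqP/eqP=> [->//|]; apply: run_inj hcs (hf i) (front_enters hcs he).
  have hcs2 : cells n la = rcons q c ++ s by rewrite cat_rcons.
  rewrite (IH _ _ hcs2 (fun i => front_step E hcs (hf i)) hrun).
  rewrite /jump_row !bound ?enters_west ?enters_north // -/(jumpable la E c).
  apply/andP/forall_inP=> [[/implyP h1 /forall_inP h2] p hp|h].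
    by rewrite inE; case: eqP => [h|_] /=; [rewrite h h1 // -h | apply: h2].
  split.
    by apply/implyP=> hc; have := h c hc; rewrite mem_head.
  by apply/forall_inP=> p hp; apply/implyP=> hps; have := h p hp; rewrite inE hps orbT.
rewrite (gen _ [::]) //; last by move=> i; apply: front_nw; apply: west_edge_nw.
apply: eq_forallb_in => p hp; have hps : in_shape la p := hT p hp.
by rewrite mem_cells hps.
Qed.

End Expansion.

(** * Restricted paths *)

Section Paths.

Variables k n : nat.
Hypothesis hkn : k <= n.
Variable la : k.-tuple nat.
Hypothesis hla : in_Lambda n la.
Variable D : filling k n.
Hypothesis hD : Go_diagram la D.
Variable F : fieldType.
Variable beta : cell k n -> F.
Hypothesis white0 : forall c, in_shape la c -> white la D c -> beta c = 0%R.
Implicit Types (c p : cell k n) (e f : edge k n).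
Implicit Types (s q : seq (cell k n)) (r : seq (edge k n)).

Lemma label_step c e : in_shape la c -> enters c e ->
  label la D (step D c e) = label la D e.
Proof.
move=> hc he; rewrite !label_endpt ?endpt_step //; first exact: inside_enters he.
exact: inside_leaves (step_leaves D he).
Qed.

Lemma label_north_west c : in_shape la c ->
  (label la D (north c) < label la D (west c)) = ~~ white la D c.
Proof.
move=> hc; rewrite (@white_pos _ _ hkn _ hla _ hD D) // negbK.
by rewrite !label_endpt //; apply: inside_enters hc _; rewrite ?enters_west ?enters_north.
Qed.

Lemma not_white c : in_shape la c -> D c || black la D c = ~~ white la D c.
Proof.
move=> hc; rewrite /white /black; case: (boolP (D c)) => //= hDc.
rewrite -leqNgt [RHS]leq_eqVlt; case: eqP => //= h.
have := pos_north_west hla D hc; rewrite -!label_endpt //; first last.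
- exact: inside_enters (enters_north c).
- exact: inside_enters (enters_west c).
rewrite -(label_step hc (enters_north c)) -(label_step hc (enters_west c)).
by rewrite step_north step_west (negPf hDc) h eqxx.
Qed.

(** A jump avoids white stones and goes to the pipe of smaller label, which then
    is at the north edge by [white_pos]; so every jump starts at a west edge. *)
Lemma path_stepE c e f : in_shape la c -> enters c e -> leaves c f ->
  path_step la D c e f =
    (f == step D c e) || [&& e == west c, f == step D c (north c) & ~~ white la D c].
Proof.
move=> hc he hf; rewrite /path_step hc -/(enters c e) -/(leaves c f) he hf /=.
have -> : (through D c f == e) = (f == step D c e).
  by apply/eqP/eqP=> [<-|->]; rewrite ?throughK ?stepK.
case: (boolP (f == _)) => //= hfs; rewrite not_white //.
have hff : f = step D c (if e == north c then west c else north c).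
  move: he hf hfs => /orP[]/eqP-> /orP[]/eqP->; rewrite ?eqxx /=;
  by rewrite !(step_north, step_west); case: (D c); rewrite ?eqxx.
rewrite {1}hff label_step //; last by case: ifP; rewrite ?enters_west ?enters_north.
case/orP: he hff => /eqP-> ->; rewrite ?eqxx /= ?eqxx ?label_north_west ?andbb //.
rewrite -label_north_west //; apply/negP=> /andP[h1 h2].
by move: (ltn_trans h1 h2); rewrite ltnn.
Qed.

Lemma step_jump_neq E c : step E c (north c) != step E c (west c).
Proof. by rewrite step_north step_west; case: (E c). Qed.

Definition path_rel e f := [exists c, path_step la D c e f].

Lemma path_rel_enters c e f : in_shape la c -> enters c e ->
  path_rel e f =
    (f == step D c e) || [&& e == west c, f == step D c (north c) & ~~ white la D c].
Proof.
move=> hc he; apply/existsP/idP=> [[c' h]|h].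
  have /and4P[hc' he' hf _] := h.
  by move: h hf; rewrite (enters_inj he' he) => h hf; rewrite -path_stepE.
exists c; rewrite path_stepE //.
by case/orP: h => [/eqP->|/and3P[_ /eqP-> _]]; rewrite step_leaves ?enters_north.
Qed.

Lemma path_rel_rank e f : path_rel e f -> rank f = (rank e).+1.
Proof.
by case/existsP=> c /and4P[_ he hf _]; rewrite (leaves_rank hf) (enters_rank he).
Qed.

(** The restricted paths from [e] through the cells [s], without their first
    edge. *)
Fixpoint paths s e : seq (seq (edge k n)) :=
  if s is c :: s' then
    if enters c e then
      [seq step D c e :: r | r <- paths s' (step D c e)] ++
      (if (e == west c) && ~~ white la D c
       then [seq step D c (north c) :: r | r <- paths s' (step D c (north c))]
       else [::])
    else paths s' e
  else [:: [::]].

Lemma mem_map_cons (f f' : edge k n) r (L : seq (seq (edge k n))) :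
  (f' :: r \in [seq f :: r' | r' <- L]) = (f' == f) && (r \in L).
Proof.
apply/mapP/andP=> [[r' hr' [-> ->]] //|[/eqP-> hr]]; by exists r.
Qed.

Lemma mem_paths q s e r : cells n la = q ++ s -> ahead la s e -> inside la e ->
  (r \in paths s e) = path path_rel e r && se_edge la (last e r).
Proof.
elim: s q e r => [|c s IH] q e r hcs ha hin /=.
  have he c : in_shape la c -> ~~ enters c e.
    by move=> hc; apply/negP=> /(ha c hc).
  rewrite inE; case: r => [|f r] /=; first by rewrite (inside_se hla).
  by apply/esym/negbTE; apply/negP=> /andP[/andP[/existsP[c /and4P[/he/negP]]]].
have hc := split_shape hcs.
have hcs2 : cells n la = rcons q c ++ s by rewrite cat_rcons.
have IHs e' : ahead la (c :: s) e' -> inside la e' -> forall r',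
    (r' \in paths s (step D c e')) =
    path path_rel (step D c e') r' && se_edge la (last (step D c e') r').
  move=> he' hin' r'; apply: (IH _ _ _ hcs2 (ahead_step hcs he')).
  exact: inside_step.
case: ifP => he; last first.
  have hse : step D c e = e by rewrite step_id // he.
  by have := IHs e ha hin r; rewrite hse.
case: r => [|f r] /=.
  rewrite mem_cat; case: ifP => _; rewrite ?in_nil.
    rewrite (_ : _ || _ = false).
      by apply/esym/negbTE; apply: contraL he => /(se_edge_exits hla hc).
    by apply/negP=> /orP[] /mapP[].
  rewrite orbF (_ : (_ \in _) = false).
    by apply/esym/negbTE; apply: contraL he => /(se_edge_exits hla hc).
  by apply/negP=> /mapP[].
rewrite mem_cat mem_map_cons (IHs e) // (path_rel_enters f hc he).
have hN : ahead la (c :: s) (north c) := proj1 (front_enters hcs (enters_north c)).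
have hiN : inside la (north c) := inside_enters hla hc (enters_north c).
rewrite (fun_if (fun L => f :: r \in L)) in_nil mem_map_cons (IHs _ hN hiN).
case: (eqVneq f (step D c e)) => [->|_] /=; last first.
  case: (e == west c) => //=; case: (white la D c); rewrite ?andbF //= andbT.
  by case: eqP => [->|].
case: ifP => [/andP[/eqP hw _]|_]; rewrite ?orbF //.
by rewrite hw eq_sym (negPf (step_jump_neq D c)) orbF.
Qed.

Lemma paths_uniq s e : uniq (paths s e).
Proof.
elim: s e => //= c s IH e; case: ifP => // he.
have consK (f : edge k n) : injective (cons f) by move=> r r' [].
rewrite cat_uniq (map_inj_uniq (consK _)) IH /=.
case: ifP => [/andP[/eqP hw _]|] //; rewrite (map_inj_uniq (consK _)) IH andbT.
apply/hasPn=> _ /mapP[r _ ->]; rewrite mem_map_cons hw.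
by rewrite (negPf (step_jump_neq D c)).
Qed.

Definition weight r : F := (\prod_(c | jump_site la D r c) beta c)%R.

Lemma jump_site_cons c c' e f r : in_shape la c -> enters c e -> path_rel e f ->
  jump_site la D [:: e, f & r] c' =
    (c' == c) && (f != step D c e) || jump_site la D (f :: r) c'.
Proof.
move=> hc he hef; rewrite /jump_site /=; congr (_ || _).
have hf : leaves c f.
  have /existsP[d /and4P[_ hd hf _]] := hef; by rewrite (enters_inj he hd).
case: (eqVneq c' c) => [->|hcc'] /=; last first.
  apply/negP=> /andP[/and4P[_ /(enters_inj he) h _ _] _].
  by case/eqP: hcc'.
have -> : path_step la D c e f by rewrite path_stepE // -path_rel_enters.
by congr (~~ _); apply/eqP/eqP=> [<-|->]; rewrite ?throughK ?stepK.
Qed.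

Lemma paths_jump s e r c : {subset s <= in_shape la} ->
  r \in paths s e -> jump_site la D (e :: r) c -> c \in s.
Proof.
elim: s e r => [|d s IH] e r hs /=; first by rewrite inE => /eqP->.
have hd : in_shape la d by apply: hs; rewrite mem_head.
have hs' : {subset s <= in_shape la} by move=> c' h; apply: hs; rewrite inE h orbT.
case: ifP => he; last by move=> h1 h2; rewrite inE (IH _ _ hs' h1 h2) orbT.
have cons_case f r' : r' \in paths s f -> path_rel e f ->
    jump_site la D [:: e, f & r'] c -> c \in d :: s.
  move=> hr' hef; rewrite (jump_site_cons _ _ hd he hef) => /orP[/andP[/eqP-> _]|].
    by rewrite mem_head.
  by move/(IH _ _ hs' hr') => h; rewrite inE h orbT.
rewrite mem_cat => /orP[/mapP[r' hr' ->]|].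
  by apply: cons_case => //; rewrite (path_rel_enters _ hd he) eqxx.
case: ifP => // hw /mapP[r' hr' ->]; apply: cons_case => //.
by rewrite (path_rel_enters _ hd he) eqxx; move: hw; case/andP=> -> ->; rewrite orbT.
Qed.

(** Splitting a path at its first cell turns the sum over paths into the recursion
    of [path_weight]; at a white stone, where no jump is possible, the jump term
    of that recursion vanishes with its parameter. *)
Lemma sum_paths s e t : {subset s <= in_shape la} -> uniq s ->
  (\sum_(r <- paths s e | edge_pos (last e r) == t) weight (e :: r) =
   path_weight D beta s e t)%R.
Proof.
elim: s e => [|c s IH] e hs /=.
  have w1 : weight [:: e] = 1%R by rewrite /weight big_pred0.
  by rewrite big_cons big_nil w1 addr0 /= => _; case: eqP.
case/andP=> hcs us; have hc : in_shape la c by apply: hs; rewrite mem_head.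
have hs' : {subset s <= in_shape la} by move=> c' h; apply: hs; rewrite inE h orbT.
case: (boolP (enters c e)) => he; last first.
  rewrite IH // step_id //; case: eqP he => [->|_ _]; last by rewrite addr0.
  by rewrite enters_west.
have wcons f r : path_rel e f -> r \in paths s f -> weight [:: e, f & r] =
    ((if f == step D c e then 1 else beta c) * weight (f :: r))%R.
  move=> hef hr; rewrite /weight.
  rewrite (eq_bigl _ _ (fun c' => jump_site_cons c' r hc he hef)).
  case: eqP => _ /=; first by rewrite mul1r; apply: eq_bigl => c'; rewrite andbF.
  have hnj : ~~ jump_site la D (f :: r) c.
    by apply: contra hcs; apply: paths_jump.
  rewrite (bigD1 c) ?eqxx //=; congr (_ * _)%R; apply: eq_bigl => c'.
  by rewrite andbT; case: eqP => [->|_] /=; rewrite ?andbT // (negPf hnj).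
rewrite big_cat big_map /=; congr (_ + _)%R.
  have hef : path_rel e (step D c e) by rewrite (path_rel_enters _ hc he) eqxx.
  rewrite -IH // big_seq_cond [RHS]big_seq_cond.
  by apply: eq_bigr => r /andP[hr _]; rewrite wcons // eqxx mul1r.
case: eqP => [hw|_] /=; last by rewrite big_nil.
case: (boolP (white la D c)) => hwh /=; first by rewrite big_nil white0 // mul0r.
have hef : path_rel e (step D c (north c)).
  by rewrite (path_rel_enters _ hc he) hw !eqxx hwh orbT.
rewrite big_map -IH // big_distrr /= big_seq_cond [RHS]big_seq_cond.
apply: eq_bigr => r /andP[hr _]; rewrite wcons // hw.
by rewrite (negPf (step_jump_neq D c)).
Qed.

Lemma path_rank e r : path path_rel e r -> rank (last e r) = rank e + size r.
Proof.
elim: r e => [|f r IH] e /=; first by rewrite addn0.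
by case/andP=> /path_rel_rank hf /IH->; rewrite hf addSnnS.
Qed.

(** Ranks increase along a path, so that no path has more than [n] edges, and the
    source is determined by its label. *)
Lemma Rtilde_path_weight e t : e \in nw_border k n ->
  Rtilde la D beta (label la D e) t = path_weight D beta (cells n la) e t.
Proof.
move=> he; rewrite -sum_paths ?cells_uniq //; last by move=> c; rewrite mem_cells.
rewrite /Rtilde -big_filter -(big_map val xpredT weight) -[RHS]big_filter.
rewrite -(big_map (cons e) xpredT weight); apply: perm_big; apply: uniq_perm.
- by rewrite (map_inj_uniq val_inj) filter_uniq // index_enum_uniq.
- have consK : injective (cons e) by move=> r r' [].
  by rewrite (map_inj_uniq consK) filter_uniq ?paths_uniq.
have hin := inside_nw la he.
have mem r := mem_paths r (erefl : cells n la = [::] ++ cells n la)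
  (@ahead_cells _ _ _ e) hin.
move=> r; apply/mapP/mapP=> [[b]|[r']].
  rewrite mem_filter => /andP[+ _] ->; case: b => -[|f r'] //= _.
  case/and5P=> hf hl hp hse ht.
  have hfe : f = e.
    move: hl; rewrite label_inj ?inside_nw // => /eqP; exact: endpt_nw_inj.
  move: hp hse ht; rewrite hfe => hp hse ht; exists r' => //.
  by rewrite mem_filter ht mem hp.
rewrite mem_filter => /andP[ht]; rewrite mem => /andP[hp hse] ->.
have hsz : size (e :: r') <= n.
  apply: leq_trans (rank_lt (last e r') hkn).
  by rewrite (path_rank hp) ltnS leq_addl.
exists (Bseq hsz) => //; rewrite mem_filter mem_index_enum andbT /=.
by rewrite he eqxx hp hse ht.
Qed.

End Paths.

(** * The determinant at the south-east border *)

Lemma enum_val_mono (n : nat) (A : {set 'I_n}) (i j : 'I_#|A|) :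
  i <= j -> enum_val i <= enum_val j.
Proof.
move=> hij; set t0 := enum_val i; rewrite !(enum_val_nth t0) -!(nth_map _ 0 val) -?cardE //.
have tr : transitive ltn by move=> a b c; apply: ltn_trans.
apply: (sorted_leq_nth leq_trans leqnn); rewrite ?inE ?size_map -?cardE //.
apply: (@sub_sorted _ ltn leq) => [a b /ltnW //|].
apply: (subseq_sorted tr _ (iota_ltn_sorted 0 n)).
by rewrite -val_enum_ord map_subseq // [enum 'I_n]enumT filter_subseq.
Qed.

Section ExitMatrix.

Variables k n : nat.
Variables (w : 'I_k -> nat) (I : {set 'I_n}) (hI : #|I| = k).
Hypothesis w_inj : injective w.
Hypothesis w_lt : forall i, w i < n.

Local Notation v := (fun j : 'I_k => enum_val (cast_ord (esym hI) j)).
Local Notation B := [set t : 'I_n | [exists i : 'I_k, w i == t :> nat]].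

Let wo i : 'I_n := Ordinal (w_lt i).

Lemma image_setE : B = [set wo i | i : 'I_k].
Proof.
apply/setP=> t; rewrite inE; apply/existsP/imsetP=> [[i /eqP h]|[i _ ->]].
  by exists i => //; apply: val_inj.
by exists i.
Qed.

Let v_inj : injective v.
Proof. by move=> i j /enum_val_inj /cast_ord_inj. Qed.

(** The labels [w] and the columns [I] being equally many, some column meets no
    label and is zero. *)
Lemma det_exit_matrix0 (F : fieldType) : B != I ->
  (\det (\matrix_(i, j) (w i == v j)%:R : 'M[F]_k) = 0)%R.
Proof.
move=> hB; have [t htI htB] : exists2 t, t \in I & t \notin B.
  apply/subsetPn; apply: contra hB => hIB.
  have wo_inj : injective wo by move=> i j [/w_inj].
  by rewrite eq_sym eqEcard hIB hI image_setE card_imset ?card_ord ?leqnn.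
have ht : t \in codom v.
  apply/codomP; exists (cast_ord hI (enum_rank_in htI t)).
  by rewrite cast_ordK enum_rankK_in.
have /codomP[j htj] := ht.
rewrite (expand_det_col _ j) big1 // => i _; rewrite mxE -htj.
case: eqP => [h|_]; last by rewrite mul0r.
by case/negP: htB; rewrite inE; apply/existsP; exists i; apply/eqP.
Qed.

Lemma sorting_perm_exists : B = I ->
  exists s : 'S_k, forall j, w (s j) = v j.
Proof.
move=> hB; have ex j : exists i, w i == v j.
  have : v j \in B by rewrite hB; apply: enum_valP.
  by rewrite inE => /existsP.
have sP j : w (xchoose (ex j)) = v j by apply/eqP/(xchooseP (ex j)).
have s_inj : injective (fun j => xchoose (ex j)).
  by move=> i j h; apply: v_inj; apply: val_inj; rewrite /= -!sP h.
by exists (perm s_inj) => j; rewrite permE.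
Qed.

(** Both permutations sort the same labels, since [enum_val] lists [I] in
    increasing order; a list has only one sorted rearrangement. *)
Lemma sorting_perm_unique (s s' : 'S_k) : (forall j, w (s j) = v j) ->
  (forall i j : 'I_k, i <= j -> w (s' i) <= w (s' j)) -> s' = s.
Proof.
move=> hs hs'; apply/permP=> j; apply: w_inj.
have srt (u : 'S_k) : (forall i j : 'I_k, i <= j -> w (u i) <= w (u j)) ->
    sorted leq [seq w (u i) | i <- enum 'I_k].
  move=> hu; apply: (homo_sorted (e := relpre val leq)); first by move=> a b; apply: hu.
  by rewrite -sorted_map val_enum_ord iota_sorted.
have pu (u : 'S_k) : perm_eq [seq w (u i) | i <- enum 'I_k] [seq w i | i <- enum 'I_k].
  rewrite (map_comp w u); apply: perm_map; apply: uniq_perm; rewrite ?enum_uniq //.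
    by rewrite (map_inj_uniq perm_inj) enum_uniq.
  by move=> i; rewrite mem_enum; apply/mapP; exists (u^-1 i)%g; rewrite ?permKV ?mem_enum.
have hsm (i l : 'I_k) : i <= l -> w (s i) <= w (s l).
  by move=> hil; rewrite !hs enum_val_mono.
have e : [seq w (s' i) | i <- enum 'I_k] = [seq w (s i) | i <- enum 'I_k].
  apply: (sorted_eq leq_trans anti_leq (srt _ hs') (srt _ hsm)).
  by rewrite (perm_trans (pu s')) // perm_sym.
by move/eq_in_map: e; apply; rewrite mem_enum.
Qed.

Lemma det_exit_matrix (F : fieldType) (s : 'S_k) : (forall j, w (s j) = v j) ->
  (\det (\matrix_(i, j) (w i == v j)%:R : 'M[F]_k) = (-1) ^+ odd_perm s)%R.
Proof.
move=> hs; rewrite -odd_permV -det_perm; congr (\det _)%R; apply/matrixP=> i j.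
by rewrite !mxE -hs (inj_eq w_inj) -[in RHS](inj_eq (@perm_inj _ s)) permKV.
Qed.

End ExitMatrix.

(** * The minors of the path matrix *)

Theorem theorem3p28 (k n : nat) (hkn : (k <= n)%N)
    (la : k.-tuple nat) (hla : in_Lambda n la)
    (D : filling k n) (hD : Go_diagram la D)
    (F : fieldType) (beta : cell k n -> F) (hbeta : jump_parameters la D beta)
    (I : {set 'I_n}) (hI : #|I| = k) :
  (max_minor (path_matrix la D beta) hI =
   \sum_(E in restricted_diagrams la D | boundary_set la E.1 == I)
     (-1) ^+ odd_perm (boundary_perm la E.1) * wt beta E)%R.
Proof.
have white0 c : in_shape la c -> white la D c -> beta c = 0%R.
  by move=> hc; case: (hbeta c hc).
pose v (j : 'I_k) : nat := enum_val (cast_ord (esym hI) j).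
have -> : max_minor (path_matrix la D beta) hI =
          (\det (path_rows D beta v (west_edge n) (cells n la)))%R.
  congr (\det _)%R; apply/matrixP=> i j; rewrite !mxE.
  exact: (Rtilde_path_weight hkn hla hD white0 _ (west_edge_nw n i)).
have west_inj : injective (@west_edge k n) by move=> i j [].
rewrite (det_path_rows white0 v (q := [::])) //; last first.
  by move=> i; apply/front_nw/west_edge_nw.
have term E : let w := west_label la E in
    (\det (exit_matrix F v (fun i => endpt la E (west_edge n i))) =
    if boundary_set la E == I then (-1) ^+ odd_perm (boundary_perm la E) else 0)%R.
  move=> w.
  have wE i : w i = edge_pos (endpt la E (west_edge n i)).
    by apply: label_nw => //; apply: west_edge_nw.
  have w_lt i : w i < n by rewrite wE edge_pos_lt.
  have w_inj : injective w.
    move=> i j; rewrite !wE => /(edge_pos_inj hla) h; apply: west_inj.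
    apply: (endpt_nw_inj (west_edge_nw n i) (west_edge_nw n j)); apply: h;
    by apply: endpt_se => //; apply/inside_nw/west_edge_nw.
  have -> : exit_matrix F v (fun i => endpt la E (west_edge n i)) =
     (\matrix_(i, j) (w i == v j)%:R)%R.
    by apply/matrixP=> i j; rewrite !mxE wE.
  case: eqP => [hB|/eqP hB]; last exact: det_exit_matrix0.
  have [s hs] := sorting_perm_exists hI hB.
  rewrite (det_exit_matrix w_inj F hs) /boundary_perm; case: pickP => [s' hs'|/(_ s)].
    rewrite (sorting_perm_unique w_inj hs (s' := s')) // => i j hij.
    by move/forallP: hs' => /(_ i)/forallP/(_ j)/implyP; apply.
  move/negP; case; apply/forallP=> i; apply/forallP=> j; apply/implyP => hij.
  by rewrite [west_label _ _ _]hs [X in _ <= X]hs enum_val_mono.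
rewrite (eq_bigr (fun T => if boundary_set la (toggled D T) == I then
  (-1) ^+ odd_perm (boundary_perm la (toggled D T)) * \prod_(b in T) beta b else 0)%R);
  last first.
  move=> T _; rewrite -[X in (_ * X)%R]/(\det (exit_matrix F v
    (fun i => endpt la (toggled D T) (west_edge n i))))%R term.
  by case: ifP => _; rewrite ?mulr0 // mulrC.
rewrite -big_mkcondr /=.
(* A restricted diagram is determined by its set of toggled cells. *)
rewrite [RHS](reindex_onto (fun T => (toggled D T, T)) (fun X => X.2)) /=; last first.
  by move=> [E T] /andP[/(restricted_diagramsP hkn hla hD)[/= -> _]].
apply: eq_bigl => T; rewrite eqxx andbT; congr (_ && _).
have sub : T \subset [set c in cells n la] = [forall c in T, in_shape la c].
  apply/subsetP/forall_inP => h c /h; by rewrite inE mem_cells.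
rewrite sub; apply/andP/idP => [[/forall_inP h1 h2]|].
  apply/(restricted_diagramsP hkn hla hD); split=> //=.
  by rewrite -(admissible_run_admissible).
move/(restricted_diagramsP hkn hla hD) => [_ /= hT].
have hs : {subset T <= in_shape la} by move=> c /(forall_inP hT)/and3P[].
by rewrite (admissible_run_admissible) //; split=> //; apply/forall_inP.
Qed.
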